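(* Assume (A1) and (A2). Let $\Gamma \subset \mathbb{Z}^d$ and $s \in (0,1/3)$. Then, for sufficiently large disorder $\lambda$, there are constants $\mu, A \in (0,\infty)$, depending only on $d$, $\rho$, $u$, $s$ and $\lambda$, such that for all $z \in \mathbb{C}\setminus\mathbb{R}$ and all $x,y \in \Gamma$ \[ \mathbb{E}\bigl\{ |G_\Gamma(z;x,y)|^{s/(2|\Theta|)} \bigr\} \le A\, e^{-\mu |x-y|_\infty}. \]
   Context: Let $d\ge 1$. For $x\in\mathbb{Z}^d$, $|x|_1=\sum_i|x_i|$ and $|x|_\infty=\max_i|x_i|$. For $\Gamma\subset\mathbb{Z}^d$, $\ell^2(\Gamma)$ is the usual Hilbert space with basis $\{\delta_k\}_{k\in\Gamma}$. The discrete Laplacian is $(\Delta\psi)(x)=\sum_{|e|_1=1}\psi(x+e)$. Let $\mu$ be a probability measure on $\mathbb{R}$, $\Omega=\times_{k\in\mathbb{Z}^d}\mathbb{R}$ with product measure $\mathbb{P}=\bigotimes_{k}\mu$; $\omega=(\omega_k)_{k\in\mathbb{Z}^d}$ are i.i.d. with law $\mu$, and $\mathbb{E}$ denotes expectation. Let $u:\mathbb{Z}^d\to\mathbb{R}$ have finite nonempty support $\Theta=\{k:u(k)\neq0\}$ with $0\in\Theta$; $|\Theta|$ is its cardinality. The potential is $V_\omega(x)=\sum_{k}\omega_k u(x-k)$ and $H_\omega=-\Delta+\lambda V_\omega$ on $\ell^2(\mathbb{Z}^d)$, $\lambda>0$. For $\Gamma\subset\mathbb{Z}^d$, $H_\Gamma$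 is the restriction of $H_\omega$ to $\ell^2(\Gamma)$ (matrix entries $\langle\delta_x,H_\omega\delta_y\rangle$, $x,y\in\Gamma$), $G_\Gamma(z)=(H_\Gamma-z)^{-1}$ and $G_\Gamma(z;x,y)=\langle\delta_x,G_\Gamma(z)\delta_y\rangle$. For $\Lambda\subset\mathbb{Z}^d$, the interior boundary is $\partial^{\rm i}\Lambda=\{k\in\Lambda:\#\{j\in\Lambda:|k-j|_1=1\}<2d\}$. Assumption (A1): $\mu$ has a bounded, compactly supported density $\rho$. Assumption (A2): $u(k)>0$ for all $k\in\partial^{\rm i}\Theta$. *)

(* Defs.v *)
From HB Require Import structures.
From mathcomp Require Import all_boot all_order all_algebra.
From mathcomp Require Import all_classical all_reals all_analysis.
From mathcomp Require Import complex.
Set Implicit Arguments. Unset Strict Implicit. Unset Printing Implicit Defensive.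
Import Order.TTheory GRing.Theory Num.Theory.
Local Open Scope classical_set_scope.
Local Open Scope ring_scope.

Definition Zd (d : nat) := 'rV[int]_d.

Definition l1norm d (x : Zd d) : nat := (\sum_(i < d) absz (x ord0 i))%N.
Definition linfnorm d (x : Zd d) : nat := (\max_(i < d) absz (x ord0 i))%N.

Definition unitv d (i : 'I_d) : Zd d := delta_mx ord0 i.

Definition cabs (R : realType) (z : R[i]) : R :=
  Num.sqrt (complex.Re z ^+ 2 + complex.Im z ^+ 2).

(* V_omega(x) = sum_k omega_k u(x-k) = sum_{j in Theta} omega_{x-j} u(j),
   where Theta (a duplicate-free list) is the support of u. *)
Definition potential (R : realType) d (u : Zd d -> R) (Theta : seq (Zd d))
  (omega : Zd d -> R) (x : Zd d) : R :=
  \sum_(j <- Theta) omega (x - j) * u j.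

Definition extz (R : realType) d (Gamma : set (Zd d)) (psi : Zd d -> R[i])
  (k : Zd d) : R[i] := if k \in Gamma then psi k else 0.

(* (H_Gamma psi)(x) for x in Gamma: restriction of -Delta + lambda V_omega to l^2(Gamma) *)
Definition HGamma (R : realType) d (u : Zd d -> R) (Theta : seq (Zd d))
  (lambda : R) (omega : Zd d -> R) (Gamma : set (Zd d)) (psi : Zd d -> R[i])
  (x : Zd d) : R[i] :=
  - (\sum_(i < d) (extz Gamma psi (x + unitv i) + extz Gamma psi (x - unitv i)))
  + ((lambda * potential u Theta omega x)%:C)%C * psi x.

Definition in_l2 (R : realType) d (Gamma : set (Zd d)) (psi : Zd d -> R[i]) :=
  (forall k, ~ Gamma k -> psi k = 0) /\
  (\esum_(k in Gamma) ((cabs (psi k)) ^+ 2)%:E < +oo)%E.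

(* psi = G_Gamma(z) delta_y, characterised as the l^2(Gamma) solution of
   (H_Gamma - z) psi = delta_y (unique for non-real z, bounded self-adjoint H_Gamma) *)
Definition resolvent_col (R : realType) d (u : Zd d -> R) (Theta : seq (Zd d))
  (lambda : R) (omega : Zd d -> R) (Gamma : set (Zd d)) (z : R[i]) (y : Zd d)
  (psi : Zd d -> R[i]) :=
  in_l2 Gamma psi /\
  forall x, Gamma x ->
    HGamma u Theta lambda omega Gamma psi x - z * psi x = (x == y)%:R.

Definition green (R : realType) d (u : Zd d -> R) (Theta : seq (Zd d))
  (lambda : R) (omega : Zd d -> R) (Gamma : set (Zd d)) (z : R[i])
  (x y : Zd d) : R[i] :=
  match pselect (exists psi, resolvent_col u Theta lambda omega Gamma z y psi) with
  | left h => (proj1_sig (cid h)) x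
  | right _ => 0
  end.

Definition interior_boundary d (Theta : seq (Zd d)) : seq (Zd d) :=
  [seq k <- Theta | (count (fun j : Zd d => l1norm (k - j)%R == 1%N) Theta < 2 * d)%N].

Definition bdd_cpt_density (R : realType) (rho : R -> R) :=
  measurable_fun setT rho /\ (forall t, 0 <= rho t) /\
  (exists C : R, forall t, rho t <= C) /\
  (exists M : R, forall t, M < `|t| -> rho t = 0) /\
  (\int[lebesgue_measure]_t (rho t)%:E = 1)%E.

Definition iid_with_density (R : realType) d (dT : measure_display)
  (T : measurableType dT) (P : probability T R) (rho : R -> R)
  (omega : Zd d -> T -> R) :=
  (forall k, measurable_fun setT (omega k)) /\
  (forall k (B : set R), measurable B ->
     P (omega k @^-1` B) = (\int[lebesgue_measure]_(t in B) (rho t)%:E)%E) /\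
  (forall (ks : seq (Zd d)) (B : Zd d -> set R), uniq ks ->
     (forall k, measurable (B k)) ->
     P (\bigcap_(k in [set` ks]) (omega k @^-1` B k)) =
     (\big[*%E/1%E]_(k <- ks) P (omega k @^-1` B k))%E).

(* Main.v *)
(* Removing from a finite volume [G] the translate [K] of the support of [u] at [k]
   gives, for the resolvent entries g,
     g_G(x, y) = sum_(c in K, b notin K, c ~ b) g_G(x, c) * g_(G \ K)(b, y),
   where the second factor does not depend on the coupling omega_k and [c] lies in
   the interior boundary of [K].  If [k] is chosen so that [x] is extremal in [K]
   in the direction opposite to [y], then [y] is not in [K] and [x] is in the interior
   boundary as well.  Exponential decay follows by iteration once the conditional
   fractional moment of g_G(x, c) given all couplings but omega_k is small at large
   disorder, for [x], [c] in the interior boundary of [K].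

   In the variable v = omega_k this entry is a quotient of two polynomials of degree
   at most |Theta|.  For v = -i Y with Y large (if Im z > 0) the operator has imaginary
   part at most -lambda Y u < 0 on the interior boundary, while in the rest of [K] the
   diagonal is large and suppresses the solution; hence the quotient is O(1 / lambda)
   there.  Lagrange interpolation of the numerator and factorisation of the denominator
   turn this into a bound of the fractional moment over real v.  Infinite volumes are
   reached by finite-volume approximation and Fatou's lemma. *)

(* A single coupling perturbs the operator by a term of rank |Theta| whose sign may vary, so neither
   a rank-one formula nor monotonicity in [omega_k] is at hand; what survives is that a resolvent
   entry is rational of bounded degree in it. The position of its poles is unknown, so averages must
   be bounded uniformly in them. This is why the exponent carries |Theta|: with t * |Theta| <= 1/2,
   the t-th power of a product of |Theta| singular factors is dominated by a sum of inverse square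
   roots, each integrable against a bounded density.

   The bound must also be uniform in z, in the volume and in the other couplings. Bounded support of
   [rho] keeps the background potential below a constant times lambda, and the conditional moment is
   at most (2 / (lambda * umin))^t times a constant. One removal of [K] produces at most 2d |Theta|
   terms and shortens the distance by a bounded amount, so the decay rate can be fixed in advance
   and paid for by the choice of lambda0.

   In infinite volume [green] is chosen separately for each omega; the comparison with finite
   volumes is therefore pointwise, and the integral of [green] is handled without measurability. *)
Require Import Defs.
From HB Require Import structures.
From mathcomp Require Import all_boot all_order all_algebra.
From mathcomp Require Import all_classical all_reals all_analysis.
From mathcomp Require Import measurable_realfun complex qpoly perm.
From mathcomp Require Import ring lra zify.
Set Implicit Arguments. Unset Strict Implicit. Unset Printing Implicit Defensive.
Import Order.TTheory GRing.Theory Num.Theory.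
Local Open Scope classical_set_scope.
Local Open Scope ring_scope.

(** * Modulus *)

Section ComplexModulus.
Context {R : realType}.
Local Notation C := R[i].
Implicit Types z w : C.

Lemma cabsE z : `|z| = ((cabs z)%:C)%C.
Proof. exact: normc_def. Qed.

Lemma cabs_ge0 z : 0 <= cabs z.
Proof. exact: sqrtr_ge0. Qed.

Lemma cabs0 : cabs (0 : C) = 0.
Proof. by apply: complexI; rewrite -cabsE normr0. Qed.

Lemma cabs1 : cabs (1 : C) = 1.
Proof. by apply: complexI; rewrite -cabsE normr1. Qed.

Lemma cabsM z w : cabs (z * w) = cabs z * cabs w.
Proof. by apply: complexI; rewrite rmorphM /= -!cabsE normrM. Qed.

Lemma cabsN z : cabs (- z) = cabs z.
Proof. by apply: complexI; rewrite -!cabsE normrN. Qed.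

Lemma cabsV z : cabs z^-1 = (cabs z)^-1.
Proof. by apply: complexI; rewrite fmorphV /= -!cabsE normfV. Qed.

Lemma cabs_eq0 z : (cabs z == 0) = (z == 0).
Proof.
by rewrite -(inj_eq (@complexI R)) -cabsE normr_eq0.
Qed.

Lemma cabs_gt0 z : z != 0 -> 0 < cabs z.
Proof. by move=> z0; rewrite lt0r cabs_eq0 z0 cabs_ge0. Qed.

Lemma ler_cabsD z w : cabs (z + w) <= cabs z + cabs w.
Proof. by rewrite -lecR rmorphD /= -!cabsE ler_normD. Qed.

Lemma ler_cabsB z w : cabs z - cabs w <= cabs (z - w).
Proof. by rewrite -lecR rmorphB /= -!cabsE lerB_dist. Qed.

Lemma ler_cabs_sum (I : Type) (r : seq I) (P : pred I) (F : I -> C) :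
  cabs (\sum_(i <- r | P i) F i) <= \sum_(i <- r | P i) cabs (F i).
Proof.
elim/big_rec2: _ => [|i x y _ h]; first by rewrite cabs0.
by rewrite (le_trans (ler_cabsD _ _))// lerD2l.
Qed.

Lemma cabs_prod (I : Type) (r : seq I) (P : pred I) (F : I -> C) :
  cabs (\prod_(i <- r | P i) F i) = \prod_(i <- r | P i) cabs (F i).
Proof. by apply: big_morph; [exact: cabsM|exact: cabs1]. Qed.

Lemma cabs_real (x : R) : cabs (x%:C)%C = `|x|.
Proof. by rewrite /cabs /= expr0n addr0 sqrtr_sqr. Qed.

Lemma cabs_sqr z : cabs z ^+ 2 = complex.Re z ^+ 2 + complex.Im z ^+ 2.
Proof. by rewrite sqr_sqrtr// addr_ge0// sqr_ge0. Qed.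

Lemma cabs_ge_Re z : `|complex.Re z| <= cabs z.
Proof. by rewrite -sqrtr_sqr ler_sqrt ?lerDl ?sqr_ge0// addr_ge0 ?sqr_ge0. Qed.

Lemma cabs_ge_Im z : `|complex.Im z| <= cabs z.
Proof. by rewrite -sqrtr_sqr ler_sqrt ?lerDr ?sqr_ge0// addr_ge0 ?sqr_ge0. Qed.

(** The bracket is the imaginary part of the conjugate of [z] times [w], the form in which the
    energy identity below produces it. *)
Lemma cabs_lagrange z w :
  `|complex.Re z * complex.Im w - complex.Im z * complex.Re w| <= cabs z * cabs w.
Proof.
case: z w => a b [c e] /=; rewrite -cabsM.
have -> : a * e - b * c = complex.Im ((a -i* b) * (c +i* e))%C by rewrite /=; ring.
apply: (le_trans (cabs_ge_Im _)); rewrite !cabsM.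
by rewrite /cabs /= sqrrN.
Qed.

End ComplexModulus.

(** * Quotients of polynomials *)

Section RationalFunctions.
Context {R : realType}.
Local Notation C := R[i].
Local Notation cabs := (@cabs R).
Implicit Types (p q : {poly C}) (x : nat -> C).

(** In each Lagrange basis polynomial the denominator is a product of distances at least 1, and the
    numerator at [v] is a product of [n] distances at most [S]. *)
Lemma lagrange_bound n x p (v : C) (S : R) :
  (forall i j, i != j -> 1 <= cabs (x i - x j)) ->
  (forall i, (i <= n)%N -> cabs (v - x i) <= S) ->
  (size p <= n.+1)%N ->
  cabs p.[v] <= S ^+ n * \sum_(i < n.+1) cabs p.[x i].
Proof.
move=> sep vS sp.
have x_inj : injective x.
  move=> i j xij; apply/eqP; apply: contraT => /sep.
  by rewrite xij subrr cabs0 ler10.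
rewrite [in leLHS](lagrange_gen (ltn0Sn n) x_inj sp) horner_sum.
apply: (le_trans (ler_cabs_sum _ _ _)).
rewrite mulr_sumr; apply: ler_sum => i _.
rewrite hornerM hornerC lagrangeE// hornerM hornerC 2!horner_prod.
rewrite !cabsM cabsV mulrC ler_wpM2r ?cabs_ge0// !cabs_prod.
have h1 : 1 <= \prod_(j < n.+1 | j != i) cabs ('X - (x j)%:P).[x i].
  elim/big_ind : _ => // [a b a1 b1|j ji].
    by rewrite -[1]mulr1 ler_pM.
  by rewrite hornerXsubC sep// eq_sym.
rewrite ler_pdivrMl; last exact: lt_le_trans h1.
have S0 : 0 <= S by exact: le_trans (cabs_ge0 _) (vS 0%N (leq0n n)).
apply: (@le_trans _ _ (S ^+ n)).
  have -> : S ^+ n = \prod_(j < n.+1 | j != i) S.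
    by rewrite prodr_const cardC1 card_ord.
  apply: ler_prod => j _; rewrite cabs_ge0 hornerXsubC vS//.
  by rewrite -ltnS.
by rewrite ler_peMl// exprn_ge0.
Qed.

(* [p] is controlled by interpolation at the points [x i], and [q] by its roots:
   [|x i - r| <= |v - r| * (1 + S / |v - r|)].  The bound also holds at the roots
   of [q], where [p.[v] / q.[v]] is [0]. *)
Lemma ratio_bound n x p q (S kappa : R) :
  (forall i j, i != j -> 1 <= cabs (x i - x j)) ->
  (size p <= n.+1)%N -> (size q <= n.+1)%N -> q != 0 -> 0 <= kappa ->
  (forall i, (i <= n)%N -> cabs p.[x i] <= kappa * cabs q.[x i]) ->
  exists2 rs : seq C, (size rs <= n)%N &
  forall v, (forall i, (i <= n)%N -> cabs (v - x i) <= S) ->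
    cabs (p.[v] / q.[v]) <=
    kappa * n.+1%:R * S ^+ n * \prod_(r <- rs) (1 + S / cabs (v - r)).
Proof.
move=> sep sp sq q0 kappa0 pq.
have [rs qE] := closed_field_poly_normal q.
have lc0 : lead_coef q != 0 by rewrite lead_coef_eq0.
exists rs => [|v vS].
  move: sq; rewrite qE size_scale// size_prod_XsubC.
  by rewrite ltnS.
have S0 : 0 <= S by exact: le_trans (cabs_ge0 _) (vS 0%N (leq0n n)).
have prod0 : 0 <= \prod_(r <- rs) (1 + S / cabs (v - r)).
  by apply: prodr_ge0 => r _; rewrite addr_ge0// divr_ge0 ?cabs_ge0.
have [qv0|qv0] := eqVneq q.[v] 0.
  by rewrite qv0 invr0 mulr0 cabs0 !mulr_ge0// exprn_ge0.
rewrite cabsM cabsV ler_pdivrMr ?cabs_gt0//.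
apply: (le_trans (lagrange_bound sep vS sp)).
have -> : forall a b c e f : R, a * b * c * e * f = c * (b * (a * (f * e))).
  by move=> *; ring.
rewrite ler_wpM2l ?exprn_ge0//.
apply: (@le_trans _ _ (\sum_(i < n.+1)
  kappa * (cabs q.[v] * \prod_(r <- rs) (1 + S / cabs (v - r))))); last first.
  by rewrite sumr_const card_ord -[leLHS]mulr_natl.
apply: ler_sum => i _; apply: (le_trans (pq _ _)); first by rewrite -ltnS.
rewrite ler_wpM2l//.
have hq w : cabs q.[w] = cabs (lead_coef q) * \prod_(r <- rs) cabs (w - r).
  rewrite {1}qE hornerZ horner_prod cabsM cabs_prod; congr (_ * _).
  by apply: eq_bigr => r _; rewrite hornerXsubC.
rewrite !hq -mulrA ler_wpM2l ?cabs_ge0// -big_split /=.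
have : forall r, r \in rs -> v != r.
  move=> r rrs; apply: contraNneq qv0 => ->.
  by rewrite -/(root q r) qE rootZ// root_prod_XsubC.
move=> vr; rewrite !(big_seq_cond xpredT); apply: ler_prod => r.
rewrite andbT => rrs; rewrite cabs_ge0/=.
have vr0 : 0 < cabs (v - r) by rewrite cabs_gt0// subr_eq0 vr.
rewrite mulrDr mulr1 mulrCA divff ?gt_eqF// mulr1.
have -> : x i - r = (v - r) - (v - x i) by ring.
by rewrite (le_trans (ler_cabsD _ _))// cabsN lerD2l vS// -ltnS.
Qed.

(** With [m] the maximum of 1 and the factors, the product is at most [m ^+ n], so its [t]-th power
    is at most the square root of [m], and that is 1 or one of the summands. This turns a product
    over unknown roots into a sum that can be integrated term by term. *)
Lemma powR_prod_le (I : Type) (rs : seq I) (f : I -> R) (n : nat) (t : R) :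
  (forall r, 1 <= f r) -> (size rs <= n)%N -> 0 <= t -> t * n%:R <= 2^-1 ->
  (\prod_(r <- rs) f r) `^ t <= 1 + \sum_(r <- rs) Num.sqrt (f r).
Proof.
move=> f1 rsn t0 tn.
have [m [m1 fm mf]] : exists m, [/\ 1 <= m, \prod_(r <- rs) f r <= m ^+ size rs &
    Num.sqrt m <= 1 + \sum_(r <- rs) Num.sqrt (f r)].
  elim: rs {rsn} => [|r rs [m [m1 fm mf]]].
    by exists 1; rewrite !big_nil sqrtr1 addr0.
  exists (Num.max m (f r)); split; first by rewrite le_max m1.
    rewrite big_cons exprS ler_pM ?prodr_ge0//.
    - exact: le_trans ler01 (f1 r).
    - by move=> i _; exact: le_trans ler01 (f1 i).
    - by rewrite le_max lexx orbT.
    - by apply: (le_trans fm); rewrite lerXn2r ?nnegrE ?le_max ?lexx// (le_trans _ m1).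
  rewrite big_cons; have : 0 <= \sum_(j <- rs) Num.sqrt (f j).
    by apply: sumr_ge0 => j _; exact: sqrtr_ge0.
  have := sqrtr_ge0 (f r); case: (leP m (f r)) => _; lra.
apply: le_trans mf; rewrite -powR12_sqrt; last lra.
apply: (@le_trans _ _ ((m ^+ n) `^ t)).
  apply: ge0_ler_powR => //; rewrite ?nnegrE.
  - by apply: prodr_ge0 => i _; exact: le_trans ler01 (f1 i).
  - by rewrite exprn_ge0//; lra.
  - by apply: (le_trans fm); rewrite ler_weXn2l.
rewrite -powR_mulrn; last lra.
by rewrite -powRrM; apply: ler_powR; rewrite // mulrC.
Qed.

End RationalFunctions.

(** * Averages over one coupling *)

Section ComplexMeasurability.
Context d (T : measurableType d) (R : realType).
Implicit Types f g : T -> R[i].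

Definition cmeasurable f :=
  measurable_fun setT (fun w => complex.Re (f w)) /\
  measurable_fun setT (fun w => complex.Im (f w)).

Lemma cmeasurable_cst (c : R[i]) : cmeasurable (fun=> c).
Proof. by split; exact: measurable_cst. Qed.

Lemma cmeasurable_real (f : T -> R) :
  measurable_fun setT f -> cmeasurable (fun w => (f w)%:C)%C.
Proof. by move=> mf; split => //; exact: measurable_cst. Qed.

Lemma cmeasurableD f g :
  cmeasurable f -> cmeasurable g -> cmeasurable (fun w => f w + g w).
Proof.
move=> [rf jf] [rg jg]; split.
  apply: eq_measurable_fun (measurable_funD rf rg) => w _ /=.
  by case: (f w) (g w) => ? ? [].
apply: eq_measurable_fun (measurable_funD jf jg) => w _ /=.
by case: (f w) (g w) => ? ? [].
Qed.

Lemma cmeasurableM f g :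
  cmeasurable f -> cmeasurable g -> cmeasurable (fun w => f w * g w).
Proof.
move=> [rf jf] [rg jg]; split.
  apply: eq_measurable_fun (measurable_funB (measurable_funM rf rg)
    (measurable_funM jf jg)) => w _ /=.
  by case: (f w) (g w) => ? ? [].
apply: eq_measurable_fun (measurable_funD (measurable_funM rf jg)
    (measurable_funM jf rg)) => w _ /=.
by case: (f w) (g w) => ? ? [].
Qed.

Lemma cmeasurable_sum (I : Type) (s : seq I) (P : pred I) (f : I -> T -> R[i]) :
  (forall i, cmeasurable (f i)) ->
  cmeasurable (fun w => \sum_(i <- s | P i) f i w).
Proof.
move=> mf; elim: s => [|i s ih].
  by under eq_fun do rewrite big_nil; exact: cmeasurable_cst.
under eq_fun do rewrite big_cons; case: (P i) => //.
exact: cmeasurableD.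
Qed.

Lemma cmeasurable_prod (I : Type) (s : seq I) (P : pred I) (f : I -> T -> R[i]) :
  (forall i, cmeasurable (f i)) ->
  cmeasurable (fun w => \prod_(i <- s | P i) f i w).
Proof.
move=> mf; elim: s => [|i s ih].
  by under eq_fun do rewrite big_nil; exact: cmeasurable_cst.
under eq_fun do rewrite big_cons; case: (P i) => //.
exact: cmeasurableM.
Qed.

Lemma cmeasurable_horner (p : {poly R[i]}) f :
  cmeasurable f -> cmeasurable (fun w => p.[f w]).
Proof.
move=> mf; under eq_fun do rewrite horner_coef.
apply: cmeasurable_sum => i; apply: cmeasurableM; first exact: cmeasurable_cst.
elim: (nat_of_ord i) => [|k ih].
  by under eq_fun do rewrite expr0; exact: cmeasurable_cst.
by under eq_fun do rewrite exprS; exact: cmeasurableM.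
Qed.

Lemma cmeasurable_det n (A : T -> 'M[R[i]]_n) :
  (forall i j, cmeasurable (fun w => A w i j)) -> cmeasurable (fun w => \det (A w)).
Proof.
move=> mA; apply: cmeasurable_sum => s; apply: cmeasurableM.
  exact: cmeasurable_cst.
exact: cmeasurable_prod.
Qed.

Lemma cmeasurable_adj n (A : T -> 'M[R[i]]_n) i j :
  (forall i j, cmeasurable (fun w => A w i j)) -> cmeasurable (fun w => (\adj (A w)) i j).
Proof.
move=> mA; under eq_fun do rewrite mxE; apply: cmeasurableM.
  exact: cmeasurable_cst.
by apply: cmeasurable_det => k l; under eq_fun do rewrite !mxE.
Qed.

Lemma measurable_cabs f : cmeasurable f -> measurable_fun setT (fun w => cabs (f w)).
Proof.
move=> [rf jf].
apply: (@eq_measurable_fun _ _ _ _ _ (fun w =>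
  (complex.Re (f w) ^+ 2 + complex.Im (f w) ^+ 2) `^ 2^-1)) => [w _|].
  by rewrite powR12_sqrt// addr_ge0 ?sqr_ge0.
apply: (@measurableT_comp _ _ _ _ _ _ (@powR R ^~ 2^-1)).
  exact: measurable_powR.
by apply: measurable_funD; exact: measurable_funX.
Qed.

Lemma measurable_cabs_div f g (t : R) : cmeasurable f -> cmeasurable g ->
  measurable_fun setT (fun w => cabs (f w / g w) `^ t).
Proof.
move=> mf mg; apply: (@measurableT_comp _ _ _ _ _ _ (@powR R ^~ t)).
  exact: measurable_powR.
(* At a zero of [g] the inverse and the power with exponent -1 are both 0, so no case distinction is
   needed. *)
apply: (@eq_measurable_fun _ _ _ _ _ (fun w => cabs (f w) * cabs (g w) `^ (-1))) => [w _|].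
  by rewrite cabsM cabsV powR_inv1// cabs_ge0.
apply: measurable_funM; first exact: measurable_cabs.
apply: (@measurableT_comp _ _ _ _ _ _ (@powR R ^~ (-1))).
  exact: measurable_powR.
exact: measurable_cabs.
Qed.

End ComplexMeasurability.

Section LawAverage.
Context {R : realType}.
Local Notation C := R[i].
Local Open Scope ereal_scope.

(** The weight is the value of the inverse square root at distance 4^-(k+1), the inner radius of the
    [k]-th shell; against a measure giving balls of radius r mass at most c * r, the integrals form
    a geometric series. *)
Definition dyadic_ind (k : nat) (a v : R) : R :=
  ((2 ^ k.+1)%:R * (`|v - a| <= 4^-1 ^+ k)%R%:R)%R.

Lemma dyadic_ind_ge0 k a v : (0 <= dyadic_ind k a v)%R.
Proof. by rewrite mulr_ge0. Qed.

(* If [4^-(k+1) < del <= 4^-k] the [k]-th term alone dominates [del^(-1/2)];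
   for [del = 0] the left-hand side is [1] since [S / 0 = 0]. *)
Lemma sqrt_dyadic (S del a v : R) : (0 <= S)%R -> (`|v - a| <= del)%R ->
  (Num.sqrt (1 + S / del))%:E <=
  (1 + S)%:E * (1 + \sum_(k <oo) (dyadic_ind k a v)%:E).
Proof.
move=> S0 vdel.
have sum0 : 0 <= \sum_(k <oo) (dyadic_ind k a v)%:E.
  by apply: nneseries_ge0 => k _ _; rewrite lee_fin dyadic_ind_ge0.
have sqrt_le (x y : R) : (0 <= y -> x <= y ^+ 2 -> Num.sqrt x <= y)%R.
  by move=> y0 /ler_wsqrtr; rewrite sqrtr_sqr ger0_norm.
have [del1|del1] := leP 1%R del.
  apply: (@le_trans _ _ (1 + S)%:E).
    rewrite lee_fin; apply: sqrt_le; first lra.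
    have : (S / del <= S)%R by rewrite ler_pdivrMr ?ler_peMr//; lra.
    by nra.
  by apply: lee_pemulr; rewrite ?lee_fin ?addr_ge0//= leeDl.
have [del0|del0] := leP del 0%R.
  have -> : del = 0%R.
    by apply/eqP; rewrite eq_le del0 (le_trans _ vdel).
  rewrite invr0 mulr0 addr0 sqrtr1 -[leLHS]mule1.
  apply: lee_pmul => //; rewrite ?lee_fin ?lerDl//.
  by rewrite leeDl.
have [k k1 k2] : exists2 k, (4^-1 ^+ k.+1 < del)%R & (del <= 4^-1 ^+ k)%R.
  have ex : exists k, (4^-1 ^+ k < del :> R)%R.
    exists (Num.bound del^-1).
    rewrite exprVn -[ltRHS](invrK del) ltf_pV2 ?posrE ?invr_gt0 ?exprn_gt0//.
    have /archi_boundP h : (0 <= del^-1)%R by rewrite invr_ge0 ltW.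
    apply: (lt_le_trans h); rewrite -natrX ler_nat ltnW//.
    exact: ltn_expl.
  case: (ex_minnP ex) => -[|k].
    by rewrite expr0 => /(lt_trans del1); rewrite ltxx.
  move=> k1 kmin; exists k => //; rewrite leNgt; apply/negP => /kmin.
  by rewrite ltnn.
have /= := @nneseries_lim_ge R (fun k => (dyadic_ind k a v)%:E) xpredT 0 k.+1
  (fun k _ _ => ltac:(by rewrite lee_fin dyadic_ind_ge0)).
rewrite big_nat_recr//= => h.
have hk : ((2 ^ k.+1)%:R)%:E <= \sum_(k <oo) (dyadic_ind k a v)%:E.
  apply: le_trans h; rewrite {2}/dyadic_ind (le_trans vdel k2) mulr1.
  by rewrite leeDr// sumEFin lee_fin sumr_ge0// => i _; rewrite dyadic_ind_ge0.
apply: (@le_trans _ _ ((1 + S)%:E * ((2 ^ k.+1)%:R)%:E)); last first.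
  apply: lee_pmul; rewrite ?lee_fin ?addr_ge0//.
  by rewrite (le_trans hk)// leeDr.
rewrite -EFinM lee_fin; apply: sqrt_le; first by rewrite mulr_ge0// addr_ge0.
have i1 : (del^-1 <= 4 ^+ k.+1)%R.
  by rewrite -[leRHS]invrK -exprVn lef_pV2 ?posrE ?exprn_gt0 ?invr_gt0 ?ltW.
have i2 : (1 <= del^-1)%R by rewrite -[leLHS]invr1 lef_pV2 ?posrE ?ltW.
rewrite exprMn natrX -exprM mulnC exprM -[(2 ^+ 2)%R]/((1 + 1) * ((1 + 1)))%R.
have -> : ((1 + 1) * (1 + 1) = 4 :> R)%R by ring.
move: i1 i2; set x := (4 ^+ _)%R; set y := (del^-1)%R => i1 i2.
have : (S * y <= S * x)%R by rewrite ler_wpM2l.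
have : (0 <= S * x)%R by rewrite mulr_ge0//; lra.
have : (0 <= S * S * x)%R by rewrite !mulr_ge0//; lra.
by rewrite expr2; lra.
Qed.

Lemma dyadic_indE k a v : (dyadic_ind k a v)%:E =
  ((2 ^ k.+1)%:R)%:E * (\1_[set v | (`|v - a| <= 4^-1 ^+ k)%R] v)%:E.
Proof.
rewrite -EFinM /dyadic_ind indicE; congr (_ * (nat_of_bool _)%:R)%:E.
by apply/idP/idP; rewrite inE.
Qed.

Lemma measurable_ball (a r : R) :
  measurable ([set v | (`|v - a| <= r)%R] : set (measurableTypeR R)).
Proof.
rewrite (_ : mkset _ = `[a - r, a + r]%classic)%R//.
by apply/seteqP; split => v /=; rewrite in_itv/= ler_distl.
Qed.

Lemma measurable_dyadic_ind k a :
  measurable_fun setT (fun v : measurableTypeR R => (dyadic_ind k a v)%:E).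
Proof.
under eq_fun do rewrite dyadic_indE.
apply: measurable_funeM; apply/measurable_EFinP; apply: measurable_indic.
exact: measurable_ball.
Qed.

Lemma integral_dyadic (nu : probability (measurableTypeR R) R) (c a : R) :
  (0 <= c)%R ->
  (forall x r : R, (0 <= r)%R -> nu [set v | (`|v - x| <= r)%R] <= (c * r)%:E) ->
  \int[nu]_v (1 + \sum_(k <oo) (dyadic_ind k a v)%:E) <= (1 + 4 * c)%:E.
Proof.
move=> c0 nub.
have mset k := measurable_ball a (4^-1 ^+ k).
have dE := dyadic_indE.
have md k := measurable_dyadic_ind k a.
have d0 k (v : measurableTypeR R) : setT v -> 0 <= (dyadic_ind k a v)%:E.
  by rewrite lee_fin dyadic_ind_ge0.
rewrite ge0_integralD//; last 2 first.
- by move=> v _; apply: nneseries_ge0 => k _ _; exact: d0.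
- by apply: ge0_emeasurable_sum => // k v Dv _; exact: d0.
rewrite integral_cst//= mul1e probability_setT EFinD leeD2l//.
rewrite integral_nneseries//.
(* Weight times mass is 2^(k+1) * c * 4^-k = 4c / 2^(k+1), whose sum is 4c. *)
apply: le_trans (@epsilon_trick0 R (4 * c) xpredT _); last by rewrite mulr_ge0.
apply: lee_nneseries => [k _ _|k _]; first by apply: integral_ge0 => v; exact: d0.
under eq_integral do rewrite dE.
rewrite ge0_integralZl//; last by apply/measurable_EFinP; exact: measurable_indic.
rewrite integral_indic// setIT.
apply: (@le_trans _ _ (((2 ^ k.+1)%:R)%:E * (c * 4^-1 ^+ k)%:E)).
  by rewrite lee_wpmul2l// ?lee_fin// nub// exprn_ge0.
rewrite -EFinM lee_fin le_eqVlt; apply/orP; left; apply/eqP.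
rewrite natrX exprVn !exprS (_ : (4 : R) = 2 * 2)%R; last by ring.
rewrite exprMn; field.
by rewrite expf_neq0.
Qed.

End LawAverage.

Section RatioAverage.
Context {R : realType}.
Local Notation C := R[i].
Local Open Scope ereal_scope.

Lemma integral_ratio (nu : probability (measurableTypeR R) R) (n : nat)
    (x : nat -> C) (p q : {poly C}) (S kappa c t M : R) :
  (0 <= c)%R ->
  (forall a r : R, (0 <= r)%R -> nu [set v | (`|v - a| <= r)%R] <= (c * r)%:E) ->
  {ae nu, forall v : measurableTypeR R, (`|v| <= M)%R} ->
  (0 <= t)%R -> (t * n%:R <= 2^-1)%R -> (0 <= S)%R -> (0 <= kappa)%R ->
  (forall i j, i != j -> (1 <= cabs (x i - x j))%R) ->
  (forall v : R, (`|v| <= M)%R -> forall i, (i <= n)%N -> (cabs ((v%:C)%C - x i) <= S)%R) ->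
  (size p <= n.+1)%N -> (size q <= n.+1)%N -> q != 0%R ->
  (forall i, (i <= n)%N -> (cabs p.[x i] <= kappa * cabs q.[x i])%R) ->
  \int[nu]_v (cabs (p.[(v%:C)%C] / q.[(v%:C)%C]) `^ t)%:E <=
  (kappa `^ t * ((n.+1%:R * S ^+ n) `^ t * (1 + n%:R * ((1 + S) * (1 + 4 * c)))))%:E.
Proof.
move=> c0 nub nuM t0 tn S0 kappa0 sep vS sp sq q0 pq.
have [rs rsn rsP] := ratio_bound S sep sp sq q0 kappa0 pq.
pose K0 : R := (kappa `^ t * (n.+1%:R * S ^+ n) `^ t)%R.
have K00 : (0 <= K0)%R by rewrite mulr_ge0 ?powR_ge0.
pose dy (r : C) (v : R) : \bar R :=
  1 + \sum_(k <oo) (dyadic_ind k (complex.Re r) v)%:E.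
have dy0 r v : 0 <= dy r v.
  by rewrite adde_ge0// nneseries_ge0// => k _ _; rewrite lee_fin dyadic_ind_ge0.
have mdy r : measurable_fun setT (dy r : measurableTypeR R -> \bar R).
  apply: emeasurable_funD => //.
  apply: ge0_emeasurable_sum => [k v _ _|k _].
    by rewrite lee_fin dyadic_ind_ge0.
  exact: measurable_dyadic_ind.
have S1 : 0 <= (1 + S)%:E by rewrite lee_fin addr_ge0.
have mdyS r : measurable_fun setT ((fun v => (1 + S)%:E * dy r v) : measurableTypeR R -> \bar R).
  exact: measurable_funeM.
have dyS0 r v : 0 <= (1 + S)%:E * dy r v by rewrite mule_ge0.
apply: (@le_trans _ _ (\int[nu]_v (K0%:E * (1 + \sum_(r <- rs) ((1 + S)%:E * dy r v))))).
  apply: ae_ge0_le_integral => //.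
  - by move=> v _; rewrite lee_fin powR_ge0.
  - apply/measurable_EFinP.
    have mC : @cmeasurable _ (measurableTypeR R) R (fun v => (v%:C)%C).
      by apply: cmeasurable_real; exact: measurable_id.
    by apply: (@measurable_cabs_div _ (measurableTypeR R) R (fun v => p.[(v%:C)%C])
       (fun v => q.[(v%:C)%C])); exact: cmeasurable_horner.
  - by move=> v _; rewrite mule_ge0// adde_ge0// sume_ge0.
  - apply: measurable_funeM; apply: emeasurable_funD => //.
    exact: emeasurable_sum.
  - apply: filterS nuM => v vM _.
    have := rsP _ (vS _ vM) => h.
    apply: (@le_trans _ _ (K0 * (1 + \sum_(r <- rs) Num.sqrt (1 + S / cabs ((v%:C)%C - r))))%:E).
      rewrite lee_fin.
      have pr0 : (0 <= \prod_(r <- rs) (1 + S / cabs ((v%:C)%C - r)))%R.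
        by apply: prodr_ge0 => r _; rewrite addr_ge0// divr_ge0 ?cabs_ge0.
      apply: (@le_trans _ _ ((kappa * n.+1%:R * S ^+ n *
          \prod_(r <- rs) (1 + S / cabs ((v%:C)%C - r))) `^ t)%R).
        apply: ge0_ler_powR => //; rewrite nnegrE ?cabs_ge0//.
        by rewrite !mulr_ge0// exprn_ge0.
      rewrite -(mulrA kappa) powRM ?mulr_ge0 ?exprn_ge0//.
      rewrite powRM ?mulr_ge0 ?exprn_ge0// ler_wpM2l//.
      apply: powR_prod_le rsn _ _ => // r.
      by rewrite lerDl divr_ge0 ?cabs_ge0.
    rewrite EFinM EFinD lee_wpmul2l ?lee_fin// leeD2l// -sumEFin.
    (* A complex root is replaced by its real part, which is no farther from the real point [v]. *)
    apply: lee_sum => r _; apply: sqrt_dyadic => //.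
    have -> : (v - complex.Re r = complex.Re ((v%:C)%C - r))%R by case: (r).
    exact: cabs_ge_Re.
rewrite ge0_integralZl_EFin//; last 2 first.
- by move=> v _; rewrite adde_ge0// sume_ge0.
- by apply: emeasurable_funD => //; exact: emeasurable_sum.
rewrite mulrA -/K0 [leRHS]EFinM lee_wpmul2l ?lee_fin//.
rewrite ge0_integralD//; last 2 first.
- by move=> v _; rewrite sume_ge0.
- exact: emeasurable_sum.
rewrite integral_cst//= mul1e probability_setT [leRHS]EFinD leeD2l//.
rewrite ge0_integral_sum//.
apply: (@le_trans _ _ (\sum_(r <- rs) ((1 + S) * (1 + 4 * c))%:E)).
  apply: lee_sum => r _; rewrite ge0_integralZl_EFin ?addr_ge0//.
  rewrite [leRHS]EFinM lee_wpmul2l//; exact: integral_dyadic.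
rewrite sumEFin big_const_seq count_predT iter_addr_0 lee_fin -[leLHS]mulr_natl.
by rewrite ler_wpM2r ?ler_nat// mulr_ge0 ?addr_ge0// mulr_ge0.
Qed.

End RatioAverage.

(** * Finite-volume operators *)

Section FiniteVolumeOperator.
Context {R : realType} {N : nat}.
Local Notation C := R[i].
Implicit Types (h : 'I_N -> 'I_N -> R) (G : {set 'I_N}) (D : 'I_N -> C).

(* The identity outside [G] makes the operators on all volumes [G] share one
   index type without changing the resolvent entries inside [G]. *)
Definition opmx h G D : 'M[C]_N := \matrix_(i, j)
  if (i \in G) && (j \in G) then (i == j)%:R * D i - ((h i j)%:C)%C else (i == j)%:R.

Lemma opmx_out h G D (phi : 'cV[C]_N) i :
  i \notin G -> (opmx h G D *m phi) i 0 = phi i 0.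
Proof.
move=> /negPf iG; rewrite mxE (bigD1 i)//= mxE iG eqxx mul1r big1 ?addr0// => j.
by rewrite eq_sym => /negPf ji; rewrite mxE iG ji mul0r.
Qed.

Lemma opmx_in h G D (phi : 'cV[C]_N) i : i \in G ->
  (opmx h G D *m phi) i 0 =
  D i * phi i 0 - \sum_(j in G) ((h i j)%:C)%C * phi j 0.
Proof.
move=> iG; rewrite mxE (bigID (mem G))/= [X in _ + X]big1 ?addr0; last first.
  move=> j jG; rewrite mxE (negPf jG) andbF.
  by case: eqP => [ij|]; rewrite ?mul0r//; move: jG; rewrite -ij iG.
rewrite (eq_bigr (fun j => (i == j)%:R * D i * phi j 0 - ((h i j)%:C)%C * phi j 0)); last first.
  by move=> j jG; rewrite mxE iG jG/= mulrBl.
rewrite sumrB; congr (_ - _).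
rewrite (bigD1 i)//= eqxx mul1r big1 ?addr0// => j /andP[_].
by rewrite eq_sym => /negPf ->; rewrite !mul0r.
Qed.

Lemma opmx_tr h G D : (forall i j, h i j = h j i) -> (opmx h G D)^T = opmx h G D.
Proof.
move=> hS; apply/matrixP => i j; rewrite !mxE andbC hS [in RHS]eq_sym.
by case: eqP => [->//|_]; rewrite !mul0r.
Qed.

(** Imaginary part of the quadratic form of [opmx]: real symmetric hopping contributes nothing, so
    only the diagonal remains. *)
Lemma opmx_energy h G D (phi : 'cV[C]_N) (f := opmx h G D *m phi) :
  (forall i j, h i j = h j i) ->
  \sum_(i in G) complex.Im (D i) * cabs (phi i 0) ^+ 2 =
  \sum_(i in G) (complex.Re (phi i 0) * complex.Im (f i 0) -
                 complex.Im (phi i 0) * complex.Re (f i 0)).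
Proof.
move=> hS; pose a i := complex.Re (phi i 0); pose b i := complex.Im (phi i 0).
(* The subtracted double sum is antisymmetric in [i] and [j], hence 0; once it is inserted, the
   identity holds for each [i] separately. *)
transitivity (\sum_(i in G) (complex.Im (D i) * cabs (phi i 0) ^+ 2 -
    \sum_(j in G) h i j * (a i * b j - b i * a j))).
  rewrite sumrB [X in _ - X](_ : _ = 0) ?subr0//.
  set Sm := \sum_(i in G) _; suff : Sm = - Sm by lra.
  rewrite {1}/Sm exchange_big /= -sumrN; apply: eq_bigr => i _.
  rewrite -sumrN; apply: eq_bigr => j _; rewrite hS; ring.
apply: eq_bigr => i iG; rewrite /f opmx_in// cabs_sqr -/(a i) -/(b i).
have -> : \sum_(j in G) ((h i j)%:C)%C * phi j 0 =
    ((\sum_(j in G) h i j * a j) +i* (\sum_(j in G) h i j * b j))%C.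
  elim/big_rec3: _ => // j x y z _ ->; rewrite /a /b.
  case: (phi j 0) => u v /=; apply/eqP; rewrite eq_complex /=.
  by rewrite !mul0r subr0 addr0 !eqxx.
have -> : \sum_(j in G) h i j * (a i * b j - b i * a j) =
    a i * (\sum_(j in G) h i j * b j) - b i * (\sum_(j in G) h i j * a j).
  rewrite !mulr_sumr -sumrB; apply: eq_bigr => j _; ring.
rewrite /a /b; case: (phi i 0) (D i) => u v [w e] /=; ring.
Qed.

Lemma opmx_energy_le h G D (phi : 'cV[C]_N) (f := opmx h G D *m phi) (sg : R) :
  (forall i j, h i j = h j i) -> `|sg| = 1 ->
  \sum_(i in G) sg * complex.Im (D i) * cabs (phi i 0) ^+ 2 <=
  \sum_(i in G) cabs (phi i 0) * cabs (f i 0).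
Proof.
move=> hS sg1.
have -> : \sum_(i in G) sg * complex.Im (D i) * cabs (phi i 0) ^+ 2 =
   sg * \sum_(i in G) complex.Im (D i) * cabs (phi i 0) ^+ 2.
  by rewrite mulr_sumr; apply: eq_bigr => i _; rewrite mulrA.
rewrite (@opmx_energy h G D phi hS) mulr_sumr; apply: ler_sum => i _.
apply: (le_trans (ler_norm _)); rewrite normrM sg1 mul1r.
exact: cabs_lagrange.
Qed.

(** Stability for the passage to infinite volume: a truncation error small in l2 forces a solution
    small in l2, with a constant independent of [G]. *)
Lemma opmx_coercive h G D (phi : 'cV[C]_N) (f := opmx h G D *m phi) (sg eta : R) :
  (forall i j, h i j = h j i) -> `|sg| = 1 -> 0 < eta ->
  (forall i, i \in G -> eta <= sg * complex.Im (D i)) ->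
  eta ^+ 2 * \sum_(i in G) cabs (phi i 0) ^+ 2 <= \sum_(i in G) cabs (f i 0) ^+ 2.
Proof.
move=> hS sg1 eta0 etaD; have := opmx_energy_le G D phi hS sg1; rewrite -/f => E.
set X := \sum_(i in G) cabs (phi i 0) ^+ 2.
set Y := \sum_(i in G) cabs (f i 0) ^+ 2.
have h1 : eta * X <= \sum_(i in G) cabs (phi i 0) * cabs (f i 0).
  apply: le_trans E; rewrite /X mulr_sumr; apply: ler_sum => i iG.
  by rewrite ler_wpM2r ?sqr_ge0// etaD.
have h2 : 2 * eta * \sum_(i in G) cabs (phi i 0) * cabs (f i 0) <= eta ^+ 2 * X + Y.
  rewrite /X /Y !mulr_sumr -big_split; apply: ler_sum => i _ /=.
  have := sqr_ge0 (eta * cabs (phi i 0) - cabs (f i 0)).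
  lra.
have : 2 * eta * (eta * X) <= 2 * eta * \sum_(i in G) cabs (phi i 0) * cabs (f i 0).
  by rewrite ler_wpM2l// mulr_ge0// ltW.
by lra.
Qed.

(** A kernel vector vanishes outside [G], where the matrix is the identity, and inside because its
    energy is zero; symmetry exchanges left and right kernels. *)
Lemma opmx_unit h G D (sg : R) :
  (forall i j, h i j = h j i) -> `|sg| = 1 ->
  (forall i, i \in G -> 0 < sg * complex.Im (D i)) ->
  opmx h G D \in unitmx.
Proof.
move=> hS sg1 sgD; rewrite unitmxE unitfE; apply/det0P => -[v v0 vM].
have Mv : opmx h G D *m v^T = 0.
  by rewrite -(@opmx_tr h G D hS) -trmx_mul vM trmx0.
have vout i : i \notin G -> v 0 i = 0.
  by move=> iG; have := opmx_out h D v^T iG; rewrite Mv !mxE.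
have vin i : i \in G -> v 0 i = 0.
  have := opmx_energy_le G D v^T hS sg1.
  rewrite [leRHS]big1; last by move=> j _; rewrite Mv [X in _ * cabs X]mxE cabs0 mulr0.
  move=> E iG; apply/eqP; rewrite -cabs_eq0 -sqrf_eq0.
  have t0 j : j \in G -> 0 <= sg * complex.Im (D j) * cabs (v^T j 0) ^+ 2.
    by move=> jG; rewrite mulr_ge0 ?sqr_ge0// ltW// sgD.
  have /eqP : \sum_(j in G) sg * complex.Im (D j) * cabs (v^T j 0) ^+ 2 == 0.
    by rewrite eq_le E sumr_ge0.
  move=> /(psumr_eq0P t0)/(_ i iG)/eqP; rewrite mulf_eq0 gt_eqF ?sgD//= mxE.
  by rewrite sqrf_eq0.
move/eqP: v0; apply; apply/rowP => i; rewrite mxE.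
by have [/vin|/vout] := boolP (i \in G).
Qed.

(* [I] is the part of the single-site support where the potential may have the
   wrong sign.  There the large diagonal makes [phi] smaller than on [B] by the
   factor [T], so that the energy contributed by [I] is absorbed by that of [B]. *)
Lemma boundary_bound h G D (B I : {set 'I_N}) (phi : 'cV[C]_N) a (D0 : C)
    (sg m m' T Delta n : R) :
  (forall i j, h i j = h j i) -> (forall i j, 0 <= h i j) -> `|sg| = 1 ->
  a \in B -> a \in G -> (forall i, i \in B -> i \notin I) ->
  (forall i, i \in G -> i \in I -> \sum_(j in G) h i j <= Delta) ->
  (forall i j, i \in G -> j \in G -> i \in I -> h i j != 0 -> (j \in B) || (j \in I)) ->
  (forall i, i \in G -> i \in I -> T * Delta <= cabs (D i)) ->
  (forall i, i \in G -> i \in B -> m <= sg * complex.Im (D i)) ->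
  (forall i, i \in G -> i \in I -> - m' <= sg * complex.Im (D i)) ->
  (forall i, i \in G -> i \notin B -> i \notin I -> 0 <= sg * complex.Im (D i)) ->
  0 < Delta -> 1 < T -> 0 < m -> 0 <= m' -> #|I|%:R <= n ->
  2 * n * m' <= T ^+ 2 * m ->
  opmx h G D *m phi = D0 *: delta_mx a 0 ->
  forall x, x \in G -> x \in B -> m * cabs (phi x 0) <= 2 * cabs D0.
Proof.
move=> hS h0 sg1 aB aG BI hDelta hnbr bigD DB DI Dout Delta0 T1 m0 m'0 In Tm Meq.
pose nrm i := cabs (phi i 0).
have n0 i : 0 <= nrm i by exact: cabs_ge0.
have aBG : (a \in B) && (a \in G) by rewrite aB.
have [x0 /andP[x0B x0G] x0max] :
    exists2 x0, (x0 \in B) && (x0 \in G) & forall x, (x \in B) && (x \in G) -> nrm x <= nrm x0.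
  exists [arg max_(i > a | (i \in B) && (i \in G)) nrm i]%O.
    by case: arg_maxP.
  by case: arg_maxP.
pose al := nrm x0.
have feq i : (opmx h G D *m phi) i 0 = D0 * (i == a)%:R.
  by rewrite Meq !mxE eqxx andbT.
have aI : a \notin I.
  exact: BI.
(* Maximum principle on [I]: at a maximum [j0] of [nrm] over [I] there is no source, and hopping
   only reaches [B] and [I]. A diagonal of modulus at least [T * Delta] with [T > 1] then forces the
   maximum to be governed by the values on [B]. *)
have beI i : i \in I -> i \in G -> T * nrm i <= al.
  move=> iI iG.
  pose P j := (j \in I) && (j \in G).
  have iP : P i by rewrite /P iI.
  pose j0 := [arg max_(j > i | P j) nrm j]%O.
  have [j0P j0max] : P j0 /\ forall j, P j -> nrm j <= nrm j0.
    by rewrite /j0; case: arg_maxP.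
  suff : T * nrm j0 <= al.
    by apply: le_trans; rewrite ler_wpM2l ?j0max//; lra.
  have /andP[j0I j0G] := j0P.
  have := feq j0; rewrite opmx_in// (_ : (j0 == a) = false); last first.
    by apply: contraNF aI => /eqP <-.
  rewrite mulr0 => /eqP; rewrite subr_eq0 => /eqP /(congr1 (@cabs R)).
  rewrite cabsM -/(nrm j0) => e.
  pose mx := Num.max al (nrm j0).
  have h1 : cabs (D j0) * nrm j0 <= Delta * mx.
    rewrite e; apply: (le_trans (ler_cabs_sum _ _ _)).
    apply: (@le_trans _ _ (\sum_(j in G) h j0 j * mx)).
      apply: ler_sum => j jG; rewrite cabsM cabs_real ger0_norm//.
      have [->|hj] := eqVneq (h j0 j) 0; first by rewrite !mul0r.
      rewrite ler_wpM2l// -/(nrm j) /mx le_max.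
      case/orP: (hnbr _ _ j0G jG j0I hj) => [jB|jI].
        by rewrite x0max// jB.
      by rewrite j0max ?orbT// /P jI.
    rewrite -mulr_suml ler_wpM2r ?hDelta// /mx le_max; apply/orP; left.
    exact: n0.
  have h2 : T * Delta * nrm j0 <= Delta * mx.
    by apply: le_trans h1; rewrite ler_wpM2r ?bigD.
  have h3 : T * nrm j0 <= mx.
    by rewrite -(ler_pM2l Delta0); lra.
  move: h3; rewrite /mx; have [//|lt_al] := leP (nrm j0) al.
  have : 0 <= al by exact: n0.
  have := n0 j0; move=> *; nra.
have al0 : 0 <= al by exact: n0.
have E := opmx_energy_le G D phi hS sg1.
rewrite [leRHS](bigD1 a)//= [X in _ <= _ + X]big1 in E; last first.
  by move=> i /andP[_ /negPf ia]; rewrite feq ia mulr0 cabs0 mulr0.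
rewrite feq eqxx mulr1 addr0 -/(nrm a) in E.
rewrite (bigID (mem I))/= in E.
have EI : - (n * m' * (al / T) ^+ 2) <=
    \sum_(i in G | i \in I) sg * complex.Im (D i) * cabs (phi i 0) ^+ 2.
  apply: (@le_trans _ _ (\sum_(i in G | i \in I) - (m' * (al / T) ^+ 2))).
    rewrite sumr_const -[leRHS]mulr_natl mulrN lerN2 -mulrA ler_wpM2r//.
      by rewrite mulr_ge0// sqr_ge0.
    apply: le_trans In; rewrite ler_nat; apply: subset_leq_card.
    by apply/fintype.subsetP => i /andP[].
  apply: ler_sum => i /andP[iG iI]; rewrite -/(nrm i).
  have h1 : nrm i ^+ 2 <= (al / T) ^+ 2.
    rewrite ler_sqr ?nnegrE// ?divr_ge0//; last lra.
    by rewrite ler_pdivlMr; [rewrite mulrC beI|lra].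
  have := DI _ iG iI; have := sqr_ge0 (nrm i); move=> *.
  apply: (@le_trans _ _ (- m' * nrm i ^+ 2)); last by rewrite ler_wpM2r.
  by rewrite mulNr lerN2 ler_wpM2l.
have EB : m * al ^+ 2 <=
    \sum_(i in G | i \notin I) sg * complex.Im (D i) * cabs (phi i 0) ^+ 2.
  rewrite (bigD1 x0)/=; last by rewrite x0G BI.
  rewrite -[leLHS]addr0 lerD//.
    by rewrite ler_wpM2r ?sqr_ge0// DB.
  apply: sumr_ge0 => i /andP[/andP[iG iI] _]; rewrite mulr_ge0 ?sqr_ge0//.
  have [iB|iB] := boolP (i \in B); last exact: Dout.
  by apply: le_trans (DB _ iG iB); exact: ltW.
have aal : nrm a <= al by apply: x0max.
have Dge := cabs_ge0 D0.
(* The negative energy on [I] consumes at most half of the energy at [x0]; this is the origin of the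
   factor 2 in the conclusion. *)
have h4 : n * m' * (al / T) ^+ 2 <= m * al ^+ 2 / 2.
  have T2 : 0 < T ^+ 2 by rewrite exprn_gt0//; lra.
  rewrite expr_div_n mulrA ler_pdivrMr//.
  have := ler_wpM2r (sqr_ge0 al) Tm; lra.
have h5 : m * al * al <= 2 * cabs D0 * al.
  have : nrm a * cabs D0 <= al * cabs D0 by rewrite ler_wpM2r.
  by rewrite expr2 in EB h4; lra.
move=> x xG xB; have xal : nrm x <= al by apply: x0max; rewrite xB.
rewrite -/(nrm x); apply: (@le_trans _ _ (m * al)); first by rewrite ler_wpM2l// ltW.
have [->|al_neq0] := eqVneq al 0; first by rewrite mulr0 mulr_ge0.
by rewrite -(@ler_pM2r _ al)// lt0r al_neq0.
Qed.

End FiniteVolumeOperator.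

(** * One-coupling averages of resolvent entries *)

Section PolynomialResolvent.

(** Each permutation picks one entry per row, so the degree is bounded by the number of rows
    containing the variable: the size of the single-site support, not of the volume. *)
Lemma size_det_le (F : comNzRingType) m (A : 'M[{poly F}]_m) (b : 'I_m -> bool) :
  (forall i j, (size (A i j) <= (b i).+1)%N) ->
  (size (\det A) <= (\sum_i b i).+1)%N.
Proof.
move=> sA; apply: (leq_trans (size_sum _ _ _)); apply/bigmax_leqP => s _.
have -> : forall p : {poly F}, size ((-1) ^+ (odd_perm s) * p) = size p.
  by move=> p; case: (odd_perm s); rewrite ?expr1 ?expr0 ?mul1r// mulN1r size_polyN.
elim/big_rec2: _ => [|i k p _ ih]; first by rewrite size_poly1.
apply: (leq_trans (size_polyMleq _ _)); move: (sA i (s i)) ih.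
rewrite addnC; set u := size _; set v := size _; set bi := nat_of_bool _; lia.
Qed.

Lemma size_adj_le (F : comNzRingType) m (A : 'M[{poly F}]_m) (b : 'I_m -> bool) i j :
  (forall i j, (size (A i j) <= (b i).+1)%N) ->
  (size ((\adj A) i j) <= (\sum_i b i).+1)%N.
Proof.
case: m A b i j => [A b []//|m A b i j sA]; rewrite mxE /cofactor.
have -> : forall p : {poly F}, size ((-1) ^+ (j + i) * p) = size p.
  move=> p; rewrite -signr_odd.
  by case: (odd _); rewrite ?expr1 ?expr0 ?mul1r// mulN1r size_polyN.
apply: (@leq_trans (\sum_k b (lift j k)).+1).
  by apply: size_det_le => k l; rewrite !mxE; exact: sA.
by rewrite ltnS [leqRHS](bigD1_ord j)//= leq_addl.
Qed.

Context {R : realType}.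
Local Notation C := R[i].

Definition opmx_poly {N} (h : 'I_N -> 'I_N -> R) (G : {set 'I_N})
    (c w : 'I_N -> C) : 'M[{poly C}]_N := \matrix_(i, j)
  if (i \in G) && (j \in G)
  then (i == j)%:R * ((c i)%:P + (w i)%:P * 'X) - (((h i j)%:C)%C)%:P else (i == j)%:R.

Lemma opmx_polyE N (h : 'I_N -> 'I_N -> R) G c w v :
  map_mx (horner_eval v) (opmx_poly h G c w) = opmx h G (fun i => c i + w i * v).
Proof.
apply/matrixP => i j; rewrite !mxE /horner_eval.
by case: ifP => _; case: (i == j); rewrite !hornerE.
Qed.

Lemma size_opmx_poly N (h : 'I_N -> 'I_N -> R) G c w i j :
  (size (opmx_poly h G c w i j) <= (w i != 0%R).+1)%N.
Proof.
rewrite mxE; case: ifP => _; last first.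
  by case: (i == j); rewrite ?size_poly1 ?size_poly0.
have sC (a : C) : (size a%:P <= (w i != 0%R).+1)%N.
  by apply: leq_trans (size_polyC_leq1 _) _.
apply: (leq_trans (size_polyD _ _)); rewrite size_polyN geq_max sC andbT.
case: (i == j); last by rewrite mul0r size_poly0.
rewrite mul1r (leq_trans (size_polyD _ _))// geq_max sC/=.
have [->|w0] := eqVneq (w i) 0; first by rewrite polyC0 mul0r size_poly0.
by rewrite size_Cmul// size_polyX.
Qed.

Lemma opmx_horner_det N (h : 'I_N -> 'I_N -> R) G c w v :
  \det (opmx h G (fun i => c i + w i * v)) = (\det (opmx_poly h G c w)).[v].
Proof. by rewrite -opmx_polyE det_map_mx. Qed.

Lemma opmx_horner_adj N (h : 'I_N -> 'I_N -> R) G c w v i j :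
  (\adj (opmx h G (fun i => c i + w i * v))) i j = ((\adj (opmx_poly h G c w)) i j).[v].
Proof. by rewrite -opmx_polyE -map_mx_adj mxE. Qed.

(** With [phi] a column of the adjugate and [D0] the determinant, [boundary_bound] compares
    numerator and denominator directly, without asking for invertibility at complex values of the
    coupling. *)
Lemma mulmx_col_adj (F : comNzRingType) N (A : 'M[F]_N) a :
  A *m col a (\adj A) = \det A *: delta_mx a 0.
Proof. by rewrite colE mulmxA mul_mx_adj mul_scalar_mx. Qed.

Lemma invmxE (F : comUnitRingType) N (A : 'M[F]_N) i j :
  A \in unitmx -> invmx A i j = (\adj A) i j / \det A.
Proof. by move=> uA; rewrite /invmx uA mxE mulrC. Qed.

(* As functions of one coupling [v], the resolvent entries are [p.[v] / q.[v]] with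
   [p], [q] of degree at most [n].  At the imaginary points [v = sg * (Y + j) * 'i]
   [boundary_bound] gives [|p| <= kappa |q|]; [Y] must be large when [z] is bounded
   by [lam * Z], while for larger [z] the diagonal is dominated by [z] and [Y = 1] works. *)
Lemma green_average (n : nat) (Delta umin umax Wm M c t : R) :
  (0 < n)%N -> 0 < Delta -> 0 < umin -> umin <= umax -> 0 <= Wm -> 0 <= M ->
  0 <= c -> 0 <= t -> t * n%:R <= 2^-1 ->
  exists2 K : R, 0 <= K &
  forall (nu : probability (measurableTypeR R) R),
  (forall a r : R, 0 <= r -> (nu [set v | (`|v - a| <= r)%R] <= (c * r)%:E)%E) ->
  {ae nu, forall v : measurableTypeR R, `|v| <= M} ->
  forall N (h : 'I_N -> 'I_N -> R) (G B I : {set 'I_N}) (us W : 'I_N -> R)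
    (lam : R) (z : C),
  (forall i j, h i j = h j i) -> (forall i j, 0 <= h i j) ->
  (forall i, i \in B -> i \notin I) ->
  (forall i, i \in B -> umin <= us i) ->
  (forall i, i \in I -> umin <= `|us i| <= umax) ->
  (forall i, i \notin B -> i \notin I -> us i = 0) ->
  (\sum_i (us i != 0%R) <= n)%N ->
  (forall i, i \in G -> i \in I -> \sum_(j in G) h i j <= Delta) ->
  (forall i j, i \in G -> j \in G -> i \in I -> h i j != 0 -> (j \in B) || (j \in I)) ->
  (forall i, i \in I -> `|W i| <= Wm) ->
  1 <= lam -> complex.Im z != 0 ->
  forall x a, x \in B -> x \in G -> a \in B -> a \in G ->
  (\int[nu]_v (cabs (invmx (opmx h G (fun i => ((lam * (W i + us i * v))%:C)%C - z)%R) x a)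
      `^ t)%:E <= ((2 / (lam * umin)) `^ t * K)%:E)%E.
Proof.
move=> n0 Delta0 umin0 uminmax Wm0 M0 c0 t0 tn.
have umax0 : 0 < umax by lra.
(* Gives [2 * n * umax <= T ^+ 2 * umin], which is the absorption condition of [boundary_bound]
   after scaling by [lam * (Y + j)]. *)
have [T TE] : exists T : R, T = 1 + 2 * n%:R * umax / umin by eexists.
have T1 : 1 < T by rewrite TE ltrDl divr_gt0// !mulr_gt0// ltr0n.
have TD0 : 0 < T * Delta by rewrite mulr_gt0//; lra.
(* If [|z| >= lam * Z], then [z] exceeds the potential, taken at coupling of modulus at most
   [1 + n], by at least [T * Delta]. *)
have [Z ZE] : exists Z : R, Z = Wm + umax * (1 + n%:R) + T * Delta by eexists.
have Z0 : 0 <= Z.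
  rewrite ZE; have : 0 <= umax * (1 + n%:R) by rewrite mulr_ge0 ?addr_ge0// ltW.
  by lra.
(* If [|z| < lam * Z], the term [lam * umin * Y0] beats [z] and the background potential with
   [T * Delta] to spare. *)
have [Y0 Y0E] : exists Y0 : R, Y0 = 1 + (Wm + Z + T * Delta) / umin by eexists.
have WZ0 : 0 <= Wm + Z + T * Delta by rewrite !addr_ge0// ltW.
have Y01 : 1 <= Y0 by rewrite Y0E lerDl divr_ge0// ltW.
have [S SE] : exists S : R, S = M + Y0 + n%:R by eexists.
have S0 : 0 <= S by rewrite SE !addr_ge0// (le_trans ler01).
exists ((n.+1%:R * S ^+ n) `^ t * (1 + n%:R * ((1 + S) * (1 + 4 * c)))).
  by rewrite mulr_ge0 ?powR_ge0// addr_ge0// mulr_ge0// mulr_ge0 ?addr_ge0// mulr_ge0.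
move=> nu nub nuM N h G B I us W lam z hS h0 BI usB usI us0 cardus hD hnbr WI lam1 z0
  x a xB xG aB aG.
have lam0 : 0 < lam by lra.
pose cc i : C := ((lam * W i)%:C)%C - z.
pose w i : C := ((lam * us i)%:C)%C.
have Dr (v : R) : (fun i => ((lam * (W i + us i * v))%:C)%C - z) =
    (fun i => cc i + w i * (v%:C)%C).
  apply/funext => i; rewrite /cc /w mulrDr rmorphD /= mulrA [(lam * us i * v)%:C%C]rmorphM /=.
  by ring.
(* With this sign, [- z] and a coupling on the imaginary half-axis of sign [sg] push the imaginary
   part of the diagonal the same way wherever [u] is positive. *)
pose sg : R := - Num.sg (complex.Im z).
have sg1 : `|sg| = 1 by rewrite normrN normr_sg z0.
have sg2 (r : R) : sg * (sg * r) = r.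
  by rewrite mulrA -expr2 -real_normK ?num_real// sg1 expr1n mul1r.
have sgz : sg * complex.Im z = - `|complex.Im z|.
  by rewrite mulNr -normrEsg.
have absz0 : 0 < `|complex.Im z| by rewrite normr_gt0.
have sgIm (v : C) i : complex.Re v = 0 -> sg * complex.Im (cc i + w i * v) =
    lam * us i * (sg * complex.Im v) + `|complex.Im z|.
  move=> v0; rewrite -[X in _ = _ + X]opprK -sgz /cc /w.
  have -> : complex.Im (((lam * W i)%:C)%C - z + ((lam * us i)%:C)%C * v) =
      lam * us i * complex.Im v - complex.Im z.
    by case: (z) (v) v0 => ? ? [? ?] /= ->; ring.
  by ring.
have unitv (v : R) : opmx h G (fun i => cc i + w i * (v%:C)%C) \in unitmx.
  apply: (@opmx_unit _ _ h G _ sg) => // i iG.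
  suff -> : sg * complex.Im (cc i + w i * (v%:C)%C) = `|complex.Im z| by [].
  rewrite -[RHS]opprK -sgz /cc /w -mulrN; congr (_ * _).
  by case: (z) => ? ? /=; ring.
pose p := (\adj (opmx_poly h G cc w)) x a.
pose q := \det (opmx_poly h G cc w).
have invE (v : R) : invmx (opmx h G (fun i => ((lam * (W i + us i * v))%:C)%C - z)) x a =
    p.[(v%:C)%C] / q.[(v%:C)%C].
  by rewrite Dr invmxE ?unitv// opmx_horner_det opmx_horner_adj.
under eq_integral do rewrite invE.
have cardw : (\sum_i (w i != 0%R) <= n)%N.
  apply: leq_trans cardus; apply: leq_sum => i _.
  rewrite /w; have [->|_] := eqVneq (us i) 0; last exact: leq_b1.
  by rewrite mulr0 eqxx.
have q0 : q != 0.
  apply/eqP => q0; have := unitv 0; rewrite unitmxE unitfE opmx_horner_det -/q q0.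
  by rewrite horner0 eqxx.
have sp : (size p <= n.+1)%N.
  apply: (leq_trans (size_adj_le _ _ (size_opmx_poly h G cc w))).
 exact: cardw.
have sq : (size q <= n.+1)%N.
  apply: (leq_trans (size_det_le (size_opmx_poly h G cc w))).
  exact: cardw.
pose pnt (Y : R) (i : nat) : C := (0 +i* (sg * (Y + i%:R)))%C.
have sep Y i j : i != j -> 1 <= cabs (pnt Y i - pnt Y j).
  move=> ij; rewrite (_ : _ - _ = (0 +i* (sg * (i%:R - j%:R)))%C); last first.
    by apply/eqP; rewrite eq_complex /=; apply/andP; split; apply/eqP; ring.
  rewrite /cabs /= expr0n add0r sqrtr_sqr normrM sg1 mul1r.
  have [/ltnW ji|ji] := ltnP j i.
    by rewrite -natrB// normr_nat ler1n subn_gt0 ltn_neqAle eq_sym ij ji.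
  by rewrite distrC -natrB// normr_nat ler1n subn_gt0 ltn_neqAle ij ji.
(* Only the lower bound for the diagonal on [I] depends on the size of [z]; [Y <= Y0] lets both
   regimes share the radius [S]. *)
have key (Y : R) : 1 <= Y -> Y <= Y0 ->
    (forall j i, (j <= n)%N -> i \in I -> T * Delta <= cabs (cc i + w i * pnt Y j)) ->
    (\int[nu]_v (cabs (p.[(v%:C)%C] / q.[(v%:C)%C]) `^ t)%:E <=
     ((2 / (lam * umin)) `^ t *
   ((n.+1%:R * S ^+ n) `^ t * (1 + n%:R * ((1 + S) * (1 + 4 * c)))))%:E)%E.
  move=> Y1 YY0 hY; apply: (@integral_ratio _ nu n (pnt Y) p q S _ c t M) => //.
  - by rewrite divr_ge0// mulr_ge0// ltW.
  - exact: sep.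
  - move=> v vM j jn; apply: (le_trans (ler_cabsD _ _)).
    rewrite cabsN cabs_real SE -addrA lerD//.
    rewrite /cabs /= expr0n add0r sqrtr_sqr normrM sg1 mul1r ger0_norm.
      by rewrite lerD// ler_nat.
    by rewrite addr_ge0//; lra.
  - move=> j jn.
    have Yj0 : 0 < Y + j%:R by rewrite ltr_wpDr//; lra.
    have Ij i : sg * complex.Im (cc i + w i * pnt Y j) =
        lam * us i * (Y + j%:R) + `|complex.Im z|.
      by rewrite sgIm//= sg2.
    have meq := mulmx_col_adj (opmx h G (fun i => cc i + w i * pnt Y j)) a.
    have := @boundary_bound _ _ h G _ B I _ a _ sg (lam * umin * (Y + j%:R))
      (lam * umax * (Y + j%:R)) T Delta n%:R hS h0 sg1 aB aG BI hD hnbr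
      _ _ _ _ Delta0 T1 _ _ _ _ meq x xG xB.
    rewrite mxE opmx_horner_det opmx_horner_adj -/p -/q => bb.
    have lu0 : 0 < lam * umin by rewrite mulr_gt0.
    have lY : 0 < lam * umin * (Y + j%:R) by rewrite mulr_gt0.
    apply: (@le_trans _ _ (2 / (lam * umin * (Y + j%:R)) * cabs q.[pnt Y j])); last first.
      rewrite ler_wpM2r ?cabs_ge0// ler_wpM2l// lef_pV2 ?posrE//.
      by rewrite ler_peMr ?(ltW lu0)// -[1]addr0 lerD.
    rewrite mulrAC ler_pdivlMr// mulrC; apply: bb => //.
    + by move=> i iG iI; exact: hY.
    + move=> i iG iB; rewrite Ij.
      have : lam * umin * (Y + j%:R) <= lam * us i * (Y + j%:R).
        by rewrite (ler_wpM2r (ltW Yj0))// (ler_wpM2l (ltW lam0))// usB.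
      by lra.
    + move=> i iG iI; rewrite Ij -!mulNr.
      have /andP[_ uu] := usI _ iI.
      have : - (lam * umax) * (Y + j%:R) <= lam * us i * (Y + j%:R).
        rewrite (ler_wpM2r (ltW Yj0))// -mulrN (ler_wpM2l (ltW lam0))//.
        by move: uu; rewrite ler_norml => /andP[].
      by lra.
    + by move=> i iG iB iI; rewrite Ij us0// mulr0 mul0r add0r ltW.
    + by rewrite !mulr_ge0// ltW.
    + rewrite ler_nat; apply: leq_trans cardus.
      rewrite -sum1_card big_mkcond; apply: leq_sum => i _.
      case: ifP => // iI; have /andP[uu _] := usI _ iI.
      by rewrite lt0b -normr_gt0; lra.
    + have hT : 2 * n%:R * umax <= T ^+ 2 * umin.
        have : (T - 1) * umin = 2 * n%:R * umax.
          by rewrite TE addrAC subrr add0r mulfVK// gt_eqF.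
        have : 0 <= T * (T - 1) * umin by rewrite !mulr_ge0//; lra.
        by rewrite expr2; nra.
      have := ler_wpM2r (mulr_ge0 (ltW lam0) (ltW Yj0)) hT; lra.
have nzR (i : 'I_N) j (Y : R) : 0 <= Y -> cabs (w i * pnt Y j) = lam * `|us i| * (Y + j%:R).
  move=> Yj0; rewrite cabsM cabs_real normrM gtr0_norm//; congr (_ * _).
  rewrite /cabs /= expr0n add0r sqrtr_sqr normrM sg1 mul1r ger0_norm//.
  by rewrite addr_ge0.
have WIl i : i \in I -> cabs ((lam * W i)%:C)%C <= lam * Wm.
  by move=> iI; rewrite cabs_real normrM gtr0_norm// ler_pM2l// WI.
have lTD : T * Delta <= lam * (T * Delta) by rewrite (ler_peMl (ltW TD0)).
have [zZ|zZ] := leP (lam * Z) (cabs z).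
  apply: (key 1) => // j i jn iI.
  rewrite /cc.
  have -> : ((lam * W i)%:C)%C - z + w i * pnt 1 j =
    - (z - (w i * pnt 1 j + ((lam * W i)%:C)%C)) by ring.
  rewrite cabsN; apply: le_trans (ler_cabsB _ _).
  have h1 := ler_cabsD (w i * pnt 1 j) ((lam * W i)%:C)%C.
  rewrite nzR// in h1; have h2 := WIl _ iI.
  have /andP[_ uu] := usI _ iI.
  have h3 : lam * `|us i| * (1 + j%:R) <= lam * (umax * (1 + n%:R)).
    rewrite -mulrA (ler_wpM2l (ltW lam0))// ler_pM// ?addr_ge0//.
    by rewrite lerD2l ler_nat.
  move: zZ; rewrite ZE !mulrDr; move: h3; rewrite !mulrDr; lra.
apply: (key Y0) => // j i jn iI.
have h0' : 0 <= Y0 by lra.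
rewrite /cc.
have -> : ((lam * W i)%:C)%C - z + w i * pnt Y0 j =
    w i * pnt Y0 j - (z - ((lam * W i)%:C)%C) by ring.
apply: le_trans (ler_cabsB _ _).
have := ler_cabsD z (- ((lam * W i)%:C)%C); rewrite cabsN nzR// => h1.
have h2 := WIl _ iI.
have /andP[uu _] := usI _ iI.
have h3 : lam * (umin * Y0) <= lam * `|us i| * (Y0 + j%:R).
  rewrite -mulrA (ler_wpM2l (ltW lam0))// ler_pM ?(ltW umin0)//.
  by rewrite lerDl.
have h4 : umin * Y0 = umin + (Wm + Z + T * Delta).
  by rewrite Y0E mulrDr mulr1 mulrCA divff ?mulr1// gt_eqF.
have : 0 <= lam * umin by rewrite mulr_ge0// ltW.
move: h3; rewrite h4 !mulrDr in lTD *; lra.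
Qed.

End PolynomialResolvent.

(** * Lattice geometry and decoupling *)

Section Lattice.
Context {d : nat}.
Implicit Types (k x y : Zd d) (Theta : seq (Zd d)).

Lemma l1norm_eq1 x : l1norm x = 1%N -> exists l, x = unitv l \/ x = - unitv l.
Proof.
move=> /eqP /sum_nat_eq1[l [_ /= xl xj]]; exists l.
have xE : x = x ord0 l *: unitv l.
  apply/rowP => j; rewrite !mxE eqxx /=.
  have [->|jl] := eqVneq j l; first by rewrite mulr1.
  by rewrite mulr0; apply/eqP; rewrite -absz_eq0 xj.
have : x ord0 l = 1 \/ x ord0 l = -1 by lia.
by case=> e; [left|right]; rewrite xE e ?scale1r ?scaleN1r.
Qed.

Definition neighbours k := [seq k + unitv l | l <- enum 'I_d] ++ [seq k - unitv l | l <- enum 'I_d].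

Lemma mem_neighboursD k l : k + unitv l \in neighbours k.
Proof. by rewrite mem_cat; apply/orP; left; apply/mapP; exists l; rewrite ?mem_enum. Qed.

Lemma mem_neighboursB k l : k - unitv l \in neighbours k.
Proof. by rewrite mem_cat; apply/orP; right; apply/mapP; exists l; rewrite ?mem_enum. Qed.

(** Such a point has at least [2 * d] distinct neighbours in [Theta], and the list [neighbours k]
    has only [2 * d] entries, so all of them are in [Theta]. *)
Lemma not_interior_boundary Theta k : uniq Theta -> k \in Theta ->
  k \notin interior_boundary Theta -> {subset neighbours k <= Theta}.
Proof.
move=> uT kT; rewrite mem_filter kT andbT -leqNgt -size_filter => cnt.
set s := seq.filter _ _ in cnt.
have sN : {subset s <= neighbours k}.
  move=> j; rewrite mem_filter => /andP[/eqP/l1norm_eq1[l kj] _].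
  rewrite mem_cat; apply/orP; case: kj => kj; [right|left];
    apply/mapP; exists l; rewrite ?mem_enum//.
    by rewrite -kj opprB addrC subrK.
  by rewrite -[unitv l]opprK -kj opprB addrC subrK.
have sz : size (neighbours k) = (2 * d)%N.
  by rewrite size_cat 2!size_map size_enum_ord mul2n addnn.
have [_ e] := uniq_min_size (filter_uniq _ uT) sN (leq_trans (eq_leq sz) cnt).
by move=> j; rewrite -e mem_filter => /andP[].
Qed.

Lemma seq_argmax (T : eqType) (s : seq T) (f : T -> int) (x0 : T) : x0 \in s ->
  exists2 x : T, x \in s & forall y : T, y \in s -> f y <= f x.
Proof.
elim: s x0 => // a [|b s] ih x0 _.
  by exists a; [exact: mem_head|move=> y; rewrite inE => /eqP ->].
have [x xs xmax] := ih b (mem_head _ _).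
have [fax|/ltW fxa] := leP (f a) (f x).
  exists x; first by rewrite inE xs orbT.
  by move=> y; rewrite inE => /orP[/eqP ->//|/xmax].
exists a; first exact: mem_head.
move=> y; rewrite inE => /orP[/eqP ->//|/xmax h].
exact: le_trans h fxa.
Qed.

(* A point of the support that is extremal in the direction from [x] to [y]:
   the translate of the support carrying it to [x] does not reach [y]. *)
Lemma extremal_boundary Theta x y : (0 < d)%N -> uniq Theta -> 0 \in Theta ->
  exists2 j, j \in interior_boundary Theta & x != y -> y - (x - j) \notin Theta.
Proof.
move=> d0 uT T0.
have [i xyi] : exists i : 'I_d, x != y -> x ord0 i != y ord0 i.
  have [->|xy] := eqVneq x y; first by exists (Ordinal d0).
  have [i xyi|h] := pickP (fun i => x ord0 i != y ord0 i); first by exists i.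
  by case/eqP: xy; apply/rowP => i; apply/eqP; have := h i => /negbFE.
have [jj|jj] := ltP (x ord0 i) (y ord0 i).
  have [j jT jmax] := seq_argmax (fun v : Zd d => v ord0 i) T0.
  exists j.
    apply: contraT => /(not_interior_boundary uT jT)/(_ (j + unitv i)).
    move=> /(_ (mem_neighboursD _ _))/jmax.
    by rewrite !mxE !eqxx/=; lia.
  move=> _; apply/negP => /jmax; rewrite !mxE.
  by move: (x ord0 i) (y ord0 i) (j ord0 i) jj => *; lia.
have [j jT jmax] := seq_argmax (fun v : Zd d => - v ord0 i) T0.
exists j.
  apply: contraT => /(not_interior_boundary uT jT)/(_ (j - unitv i)).
  move=> /(_ (mem_neighboursB _ _))/jmax.
  by rewrite !mxE !eqxx/=; lia.
move=> /xyi ne; apply/negP => /jmax; rewrite !mxE.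
by move: (x ord0 i) (y ord0 i) (j ord0 i) jj ne => *; lia.
Qed.

Lemma linfnormD x y : (linfnorm (x + y)%R <= linfnorm x + linfnorm y)%N.
Proof.
apply/bigmax_leqP => i _; rewrite !mxE.
apply: (@leq_trans (absz (x ord0 i) + absz (y ord0 i))%N).
  by move: (x ord0 i) (y ord0 i) => a b; lia.
apply: leq_add; rewrite /linfnorm.
  exact: (@leq_bigmax _ (fun i => absz (x ord0 i))).
exact: (@leq_bigmax _ (fun i => absz (y ord0 i))).
Qed.

End Lattice.

Section Hopping.
Context {R : realType} {d N : nat} (pt : 'I_N -> Zd d).
Hypothesis pt_inj : injective pt.

Definition hop (i j : 'I_N) : R :=
  \sum_(l < d) ((pt j == pt i + unitv l)%:R + (pt j == pt i - unitv l)%:R).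

Lemma hop_sym i j : hop i j = hop j i.
Proof.
apply: eq_bigr => l _; rewrite addrC; congr (_%:R + _%:R); congr (nat_of_bool _).
  by rewrite -subr_eq opprK eq_sym.
by rewrite -subr_eq eq_sym.
Qed.

Lemma hop_ge0 i j : 0 <= hop i j.
Proof. by apply: sumr_ge0 => l _; rewrite addr_ge0. Qed.

Lemma hop_neq0 i j : hop i j != 0 -> pt j \in neighbours (pt i).
Proof.
apply: contraNT => h; rewrite /hop big1// => l _.
have [e|_] := eqVneq (pt j) (pt i + unitv l).
  by rewrite e mem_neighboursD in h.
have [e|_] := eqVneq (pt j) (pt i - unitv l); last by rewrite addr0.
by rewrite e mem_neighboursB in h.
Qed.

(** Integrality of the hopping; it lets the [t]-th power of a hopping coefficient be bounded by the
    coefficient itself in [decoupling_powR]. *)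
Lemma hop_ge1 i j : hop i j != 0 -> 1 <= hop i j.
Proof.
have -> : hop i j = (\sum_(l < d) ((pt j == pt i + unitv l)%R + (pt j == pt i - unitv l)%R)%N)%:R.
  by rewrite natr_sum; apply: eq_bigr => l _; rewrite natrD.
by rewrite pnatr_eq0 ler1n lt0n.
Qed.

Lemma sum_pt_eq (G : {set 'I_N}) c : \sum_(j in G) (pt j == c)%:R <= 1 :> R.
Proof.
have [j0 /eqP e|h] := pickP (fun j => pt j == c).
  apply: (@le_trans _ _ (\sum_j (j == j0)%:R)).
    rewrite [leLHS]big_mkcond; apply: ler_sum => j _; rewrite -e (inj_eq pt_inj).
    by case: ifP.
  by rewrite (bigD1 j0)//= eqxx big1 ?addr0// => j /negPf ->.
by rewrite big1// => j _; rewrite h.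
Qed.

Lemma hop_row_sum (G : {set 'I_N}) i : \sum_(j in G) hop i j <= (2 * d)%:R.
Proof.
rewrite exchange_big /=.
apply: (@le_trans _ _ (\sum_(l < d) 2)).
  apply: ler_sum => l _; rewrite big_split /= -[2]/(1 + 1).
  by apply: lerD; exact: sum_pt_eq.
by rewrite sumr_const card_ord natrM mulr_natr.
Qed.

End Hopping.

Section Resolvent.
Context {R : realType} {N : nat}.
Local Notation C := R[i].
Implicit Types (h : 'I_N -> 'I_N -> R) (D : 'I_N -> C) (G K : {set 'I_N}).

Lemma resolvent_out h D G (y b : 'I_N) : opmx h G D \in unitmx -> y \in G -> b \notin G ->
  invmx (opmx h G D) b y = 0.
Proof.
move=> uM yG bG; have := opmx_out h D (col y (invmx (opmx h G D))) bG.
rewrite {1}colE mulmxA mulmxV// mul1mx [in RHS]mxE => <-; rewrite mxE.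
by rewrite eqxx andbT; case: eqP => // by_; rewrite -by_ (negPf bG) in yG.
Qed.

(** Geometric resolvent identity. The column [psi] of the depleted resolvent, seen in [G], solves
    the full equation up to a source [r] supported on [K], fed by hopping across the boundary of
    [K]. Inverting and evaluating at [x] in [K], where [psi] vanishes, leaves exactly the sum. *)
Lemma resolvent_decoupling h D G K (x y : 'I_N) :
  opmx h G D \in unitmx -> opmx h (G :\: K) D \in unitmx ->
  x \in G -> x \in K -> y \in G -> y \notin K ->
  invmx (opmx h G D) x y =
  \sum_(c in G :&: K) \sum_(b in G :\: K)
    invmx (opmx h G D) x c * ((h c b)%:C)%C * invmx (opmx h (G :\: K) D) b y.
Proof.
move=> uM uM' xG xK yG yK; set A := invmx (opmx h G D).
set M' := opmx h (G :\: K) D; set B := invmx M'.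
pose psi : 'cV[C]_N := col y B.
have yG' : y \in G :\: K by rewrite inE yK.
have psi_out b : b \notin G :\: K -> psi b 0 = 0.
  by move=> bG; rewrite mxE resolvent_out.
have M'psi : M' *m psi = delta_mx y 0.
  by rewrite /psi colE mulmxA mulmxV// mul1mx.
have sumG i : \sum_(j in G) ((h i j)%:C)%C * psi j 0 =
    \sum_(j in G :\: K) ((h i j)%:C)%C * psi j 0.
  rewrite (bigID (mem K))/= big1 ?add0r; last first.
    by move=> j /andP[jG jK]; rewrite psi_out ?mulr0// inE jK.
  by apply: eq_bigl => j; rewrite inE andbC.
pose r : 'cV[C]_N := \col_i
  if i \in G :&: K then \sum_(b in G :\: K) ((h i b)%:C)%C * psi b 0 else 0.
have Mpsi : opmx h G D *m psi = delta_mx y 0 - r.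
  apply/colP => i; rewrite [RHS]mxE [X in _ = _ + X]mxE [r _ _]mxE.
  have [iG|iG] := boolP (i \in G); last first.
    rewrite opmx_out// inE (negPf iG) subr0 mxE.
    by rewrite -M'psi opmx_out ?mxE// inE (negPf iG) andbF.
  rewrite opmx_in// sumG inE iG /=.
  have [iK|iK] := boolP (i \in K).
    rewrite psi_out ?inE ?iK// mulr0 add0r mxE eqxx andbT.
    by case: eqP => [iy|]; rewrite ?sub0r//; move: yK; rewrite -iy iK.
  by rewrite subr0 -M'psi opmx_in// inE iK.
have /(congr1 (mulmx A)) := Mpsi.
rewrite mulmxA mulVmx// mul1mx mulmxBr => /colP/(_ x).
rewrite psi_out ?inE ?xK// => /esym/eqP; rewrite mxE [X in _ + X]mxE subr_eq0.
rewrite -colE mxE => /eqP ->; rewrite mxE.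
rewrite [RHS]big_mkcond /=; apply: eq_bigr => c _; rewrite mxE.
case: ifP => _; last by rewrite mulr0.
rewrite mulr_sumr; apply: eq_bigr => b _; rewrite mulrA; congr (_ * _).
by rewrite mxE.
Qed.

End Resolvent.

(** * Independence *)

Section Independence.
Context {R : realType} {d : nat} {dT : measure_display} {T : measurableType dT}.
Context {P : probability T R} {rho : R -> R} {omega : Zd d -> T -> R}.
Hypothesis iid : iid_with_density P rho omega.
Local Open Scope ereal_scope.

Lemma coupling_measurable k : measurable_fun setT (omega k).
Proof. by case: iid. Qed.

Definition coupling_law k : probability (measurableTypeR R) R :=
  distribution P
    (@mfun_Sub _ _ T (measurableTypeR R) (omega k) (mem_set (coupling_measurable k))).

Lemma coupling_lawE k B : coupling_law k B = P (omega k @^-1` B).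
Proof. by []. Qed.

(* The sigma-algebra of the couplings other than [k] is put on a copy of [T], so
   that independence becomes a statement about a product measure. *)
Definition other_cylinders k : set (set T) :=
  [set A | exists ks (B : Zd d -> set R), [/\ uniq ks, k \notin ks,
    forall j, measurable (B j) & A = \bigcap_(j in [set` ks]) (omega j @^-1` B j)]].

Local Notation others k := (g_sigma_algebraType (other_cylinders k)).

Lemma preimage_coupling_measurable k (B : set R) : measurable B ->
  measurable (omega k @^-1` B).
Proof.
by move=> mB; rewrite -[X in measurable X]setTI; exact: coupling_measurable.
Qed.

Lemma other_cylinders_measurable k : other_cylinders k `<=` measurable.
Proof.
move=> _ [ks [B [_ _ mB ->]]]; apply: fin_bigcap_measurable => // j _.
exact: preimage_coupling_measurable.
Qed.

Lemma other_cylindersT k : other_cylinders k setT.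
Proof.
exists [::], (fun=> setT); split => //.
by rewrite bigcap_seq big_nil.
Qed.

Lemma other_cylinders_setI k : setI_closed (other_cylinders k).
Proof.
move=> _ _ [ks [B [uks kks mB ->]]] [ks' [B' [uks' kks' mB' ->]]].
exists (undup (ks ++ ks')), (fun j => (if j \in ks then B j else setT) `&`
   (if j \in ks' then B' j else setT)); split.
- exact: undup_uniq.
- by rewrite mem_undup mem_cat negb_or kks.
- by move=> j; apply: measurableI; case: ifP.
apply/seteqP; split => w /=.
  move=> [h h'] j /= _; split.
    by case: ifPn => // jks; exact: h.
  by case: ifPn => // jks; exact: h'.
move=> h; split => j /= jks.
  by have := h j; rewrite /= mem_undup mem_cat jks => /(_ isT)[].
by have := h j; rewrite /= mem_undup mem_cat jks orbT => /(_ isT)[].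
Qed.

Lemma others_measurable k (E : set T) :
  measurable (E : set (others k)) -> measurable E.
Proof.
apply: smallest_sub => //; first exact: sigma_algebra_measurable.
exact: other_cylinders_measurable.
Qed.

(** For fixed [A] both sides are finite measures in [E]. They agree on the intersection-stable
    cylinders by the product formula for [k :: ks], hence on the generated sigma-algebra. *)
Lemma coupling_indep k (A : set R) (E : set T) : measurable A ->
  measurable (E : set (others k)) ->
  P (omega k @^-1` A `&` E) = P (omega k @^-1` A) * P E.
Proof.
move=> mA; have mkA := preimage_coupling_measurable k mA.
have fA : P (omega k @^-1` A) \is a fin_num by exact: fin_num_measure.
have pA : (0 <= fine (P (omega k @^-1` A)))%R by exact: fine_ge0.
pose m1 := mrestr P mkA; pose m2 := mscale (NngNum pA) P.
have m12 E' : other_cylinders k E' -> m1 E' = m2 E'.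
  case=> ks [B [uks kks mB ->]].
  rewrite /m1 /m2 /mrestr /mscale /= fineK// setIC.
  case: iid => _ [_ prod].
  pose B' j := if j == k then A else B j.
  have mB' j : measurable (B' j) by rewrite /B'; case: ifP.
  have uk : uniq (k :: ks) by rewrite /= kks.
  have B'E : {in ks, forall j, B' j = B j}.
    by move=> j jks; rewrite /B'; case: eqP => // jk; move: kks; rewrite -jk jks.
  have := prod _ _ uk mB'; rewrite big_cons {2}/B' eqxx.
  rewrite !bigcap_seq big_cons {1}/B' eqxx.
  rewrite (eq_big_seq (fun j => omega j @^-1` B j)); last first.
    by move=> j jks /=; rewrite B'E.
  move=> ->; congr (_ * _).
  have := prod _ _ uks mB; rewrite bigcap_seq => ->.
  by apply: eq_big_seq => j jks; rewrite B'E.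
move=> mE; have : m1 E = m2 E.
  apply: (@g_sigma_algebra_measure_unique _ _ _ (other_cylinders k)
    (@other_cylinders_measurable k) (fun=> setT)) => //.
  - by move=> _; exact: other_cylindersT.
  - by apply/seteqP; split => // w _; exists 0%N.
  - exact: other_cylinders_setI.
  - by move=> _; rewrite /m1 /= /mrestr setTI ltey_eq fA.
by rewrite /m1 /m2 /mrestr /mscale /= fineK// setIC.
Qed.

Lemma measurable_id_others k : measurable_fun setT (idfun : T -> others k).
Proof. by move=> _ E mE; rewrite setTI; exact: (others_measurable mE). Qed.

Definition others_law k : probability (others k) R :=
  distribution P (mfun_Sub (mem_set (@measurable_id_others k))).

Lemma measurable_coupling_pair k :
  measurable_fun setT (fun w => (omega k w, w) : measurableTypeR R * others k).
Proof.
apply: measurable_fun_pair; first exact: coupling_measurable.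
exact: measurable_id_others.
Qed.

Definition pair_law k : probability (measurableTypeR R * others k)%type R :=
  distribution P (mfun_Sub (mem_set (@measurable_coupling_pair k))).

(** Independence makes the law of the pair a product measure, and Tonelli integrates the coupling at
    [k] first, with the others frozen. *)
Lemma integral_coupling k (f : measurableTypeR R * others k -> \bar R) :
  measurable_fun setT f -> (forall x, 0 <= f x) ->
  \int[P]_w f (omega k w, w) = \int[P]_w \int[coupling_law k]_v f (v, w).
Proof.
move=> mf f0.
transitivity (\int[pair_law k]_x f x).
  by rewrite /pair_law /distribution ge0_integral_pushforward.
transitivity (\int[(coupling_law k \x others_law k)%E]_x f x).
  apply: eq_measure_integral => X mX _; apply/esym.
  apply: product_measure_unique => // A B mA mB.
  by rewrite -[RHS]/(P (omega k @^-1` A) * P B) -coupling_indep.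
rewrite fubini_tonelli2//.
transitivity (\int[others_law k]_w (fubini_G (coupling_law k) f) w) => //.
have mG := @measurable_fun_fubini_tonelli_G _ _ _ _ R (coupling_law k) f mf f0.
rewrite /others_law /distribution ge0_integral_pushforward//=.
  exact: measurable_id_others.
by move=> w _; apply: integral_ge0 => v _; exact: f0.
Qed.

Lemma integral_coupling_le k (f : measurableTypeR R * others k -> \bar R) (g : T -> \bar R) :
  measurable_fun setT f -> (forall x, 0 <= f x) ->
  measurable_fun setT g -> (forall w, 0 <= g w) ->
  {ae P, forall w, \int[coupling_law k]_v f (v, w) <= g w} ->
  \int[P]_w f (omega k w, w) <= \int[P]_w g w.
Proof.
move=> mf f0 mg g0 fg; rewrite integral_coupling//.
apply: ae_ge0_le_integral => //.
- by move=> w _; apply: integral_ge0 => v _; exact: f0.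
- have mG := @measurable_fun_fubini_tonelli_G _ _ _ _ R (coupling_law k) f mf f0.
  exact: (measurableT_comp mG (@measurable_id_others k)).
- move: fg => [E [mE PE fE]]; exists E; split => // w /= hw.
  by apply: fE => h; apply: hw.
Qed.

Lemma measurable_other_coupling k j : j != k ->
  measurable_fun setT (omega j : others k -> R).
Proof.
move=> jk _ B mB; rewrite setTI; apply: sub_sigma_algebra.
exists [:: j], (fun=> B); split => //; first by rewrite inE eq_sym.
by rewrite bigcap_seq big_seq1.
Qed.

Lemma coupling_law_ball (c : R) k :
  (forall t, 0 <= rho t <= c)%R -> measurable_fun setT rho ->
  forall a r : R, (0 <= r)%R ->
  coupling_law k [set v | (`|v - a| <= r)%R] <= (2 * c * r)%:E.
Proof.
move=> rhoc mrho a r r0; rewrite coupling_lawE.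
case: iid => _ [dens _].
rewrite dens; last exact: measurable_ball.
have c0 : (0 <= c)%R by have /andP[? ?] := rhoc 0%R; lra.
rewrite (_ : mkset _ = `[a - r, a + r]%classic)%R; last first.
  by apply/seteqP; split => v /=; rewrite in_itv/= ler_distl.
apply: (@le_trans _ _ (\int[lebesgue_measure]_(t in `[(a - r)%R, (a + r)%R]%classic) c%:E)).
  apply: ge0_le_integral => //.
  - by move=> t _; rewrite lee_fin; have /andP[] := rhoc t.
  - apply/measurable_EFinP; exact: measurable_funTS.
  - by move=> t _; rewrite lee_fin; have /andP[] := rhoc t.
rewrite integral_cst//= lebesgue_measure_itv /= lte_fin.
case: ifPn => _; last by rewrite mule0 lee_fin !mulr_ge0.
by rewrite -EFinB -EFinM lee_fin; lra.
Qed.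

Lemma coupling_bounded (M : R) k : (forall t, M < `|t| -> rho t = 0)%R ->
  P (omega k @^-1` [set v | (M < `|v|)%R]) = 0.
Proof.
move=> rhoM; case: iid => _ [dens _].
have mM : measurable ([set v | (M < `|v|)%R] : set (measurableTypeR R)).
  rewrite (_ : mkset _ = ~` [set v | (`|v - 0| <= M)%R]).
    by apply: measurableC; exact: measurable_ball.
  by apply/seteqP; split => v /=; rewrite subr0 ltNge => /negP.
rewrite dens// integral0_eq// => t /= Mt; by rewrite rhoM.
Qed.

Lemma ae_coupling_bounded (M : R) k : (forall t, M < `|t| -> rho t = 0)%R ->
  {ae P, forall w, (`|omega k w| <= M)%R}.
Proof.
move=> rhoM; exists (omega k @^-1` [set v | (M < `|v|)%R]); split.
- apply: preimage_coupling_measurable.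
  rewrite (_ : mkset _ = ~` [set v | (`|v - 0| <= M)%R]).
    by apply: measurableC; exact: measurable_ball.
  by apply/seteqP; split => v /=; rewrite subr0 ltNge => /negP.
- exact: coupling_bounded.
- by move=> w /= /negP; rewrite -ltNge.
Qed.

Lemma ae_coupling_law_bounded (M : R) k : (forall t, M < `|t| -> rho t = 0)%R ->
  {ae coupling_law k, forall v : measurableTypeR R, (`|v| <= M)%R}.
Proof.
move=> rhoM; exists [set v | (M < `|v|)%R]; split.
- rewrite (_ : mkset _ = ~` [set v | (`|v - 0| <= M)%R]).
    by apply: measurableC; exact: measurable_ball.
  by apply/seteqP; split => v /=; rewrite subr0 ltNge => /negP.
- by rewrite coupling_lawE coupling_bounded.
- by move=> w /= /negP; rewrite -ltNge.
Qed.

End Independence.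

(** * Fractional moments in finite volume *)

Section FractionalPowers.
Context {R : realType}.

(** After division by [a + b] this is the fact that a number in [0, 1] is at most its [t]-th
    power. *)
Lemma powR_subadditive (t a b : R) : 0 < t -> t <= 1 -> 0 <= a -> 0 <= b ->
  (a + b) `^ t <= a `^ t + b `^ t.
Proof.
move=> t0 t1 a0 b0; have [ab0|ab0] := eqVneq (a + b) 0.
  by rewrite ab0 powR0 ?gt_eqF// addr_ge0 ?powR_ge0.
have s0 : 0 < a + b by rewrite lt0r ab0 addr_ge0.
have key c : 0 <= c -> c <= a + b -> (a + b) `^ t * (c / (a + b)) <= c `^ t.
  move=> c0 cab; have [->|cn0] := eqVneq c 0; first by rewrite mul0r mulr0 powR_ge0.
  have -> : c `^ t = (a + b) `^ t * (c / (a + b)) `^ t.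
    have e : (a + b) * (c / (a + b)) = c by rewrite mulrCA divff ?mulr1.
    by rewrite -powRM ?e// ?(ltW s0)// divr_ge0// ltW.
  rewrite ler_wpM2l ?powR_ge0// ger1_powR// divr_gt0//= ?lt0r ?cn0//.
  by rewrite ler_pdivrMr// mul1r.
have -> : (a + b) `^ t = (a + b) `^ t * (a / (a + b)) + (a + b) `^ t * (b / (a + b)).
  by rewrite -mulrDr -mulrDl divff// mulr1.
by apply: lerD; apply: key; rewrite ?lerDl ?lerDr.
Qed.

Lemma powR_sum_le (I : Type) (s : seq I) (P : pred I) (f : I -> R) (t : R) :
  0 < t -> t <= 1 -> (forall i, 0 <= f i) ->
  (\sum_(i <- s | P i) f i) `^ t <= \sum_(i <- s | P i) f i `^ t.
Proof.
move=> t0 t1 f0; elim: s => [|i s ih]; first by rewrite !big_nil powR0 ?gt_eqF.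
rewrite !big_cons; case: (P i) => //.
apply: (le_trans (powR_subadditive t0 t1 _ _)); rewrite ?f0 ?sumr_ge0//.
by rewrite lerD2l.
Qed.

End FractionalPowers.

Section FiniteVolumeGreen.
Context {R : realType} {d : nat}.
Local Notation C := R[i].
Variables (u : Zd d -> R) (Theta : seq (Zd d)).

(** Splits a configuration into the coupling at [k] and the rest, so that functions of it are
    measurable on the product used in [integral_coupling]. *)
Definition resample (omega : Zd d -> R) (k : Zd d) (v : R) (j : Zd d) : R :=
  if j == k then v else omega j.

Lemma resample_id omega k : resample omega k (omega k) = omega.
Proof. by apply/funext => j; rewrite /resample; case: eqP => [->|]. Qed.

Definition gmx N (pt : 'I_N -> Zd d) (lam : R) (z : C) (G : {set 'I_N})
    (omega : Zd d -> R) : 'M[C]_N :=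
  opmx (hop pt) G (fun i => ((lam * potential u Theta omega (pt i))%:C)%C - z).

Definition gfin N (pt : 'I_N -> Zd d) lam z G omega := invmx (gmx pt lam z G omega).

Lemma gmx_unit N (pt : 'I_N -> Zd d) lam z G omega : complex.Im z != 0 ->
  gmx pt lam z G omega \in unitmx.
Proof.
move=> z0; apply: (@opmx_unit _ _ _ G _ (- Num.sg (complex.Im z))).
- exact: hop_sym.
- by rewrite normrN normr_sg z0.
- move=> i iG; have -> : complex.Im (((lam * potential u Theta omega (pt i))%:C)%C - z) =
      - complex.Im z by case: (z) => ? ? /=; rewrite sub0r.
  by rewrite mulrNN -normrEsg normr_gt0.
Qed.

Lemma measurable_gfin N (pt : 'I_N -> Zd d) lam z G (dS : measure_display)
    (S : measurableType dS) (omega : Zd d -> S -> R) t x y :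
  complex.Im z != 0 -> (forall k, measurable_fun setT (omega k)) ->
  measurable_fun setT (fun s => cabs (gfin pt lam z G (fun k => omega k s) x y) `^ t).
Proof.
move=> z0 momega.
have mM i j : cmeasurable (fun s => gmx pt lam z G (fun k => omega k s) i j).
  rewrite /gmx; under eq_fun do rewrite mxE.
  case: ((i \in G) && (j \in G)); last exact: cmeasurable_cst.
  apply: cmeasurableD; last exact: cmeasurable_cst.
  apply: cmeasurableM; first exact: cmeasurable_cst.
  apply: cmeasurableD; last exact: cmeasurable_cst.
  apply: cmeasurable_real; apply: measurable_funM; first exact: measurable_cst.
  apply: (@measurable_sum _ _ _ _ _ Theta (fun j s => omega (pt i - j) s * u j)) => l.
  by apply: measurable_funM => //; exact: measurable_cst.
apply: eq_measurable_fun (measurable_cabs_div t (cmeasurable_adj x y mM)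
  (cmeasurable_det mM)) => s _.
by rewrite /gfin invmxE// gmx_unit.
Qed.

Hypothesis uT : uniq Theta.
Hypothesis uTheta : forall k, u k != 0 <-> k \in Theta.

Lemma u_out k : k \notin Theta -> u k = 0.
Proof. by move=> kT; apply/eqP; apply: contraNT kT => /uTheta. Qed.

Lemma potential_resample omega k v x :
  potential u Theta (resample omega k v) x =
  potential u Theta (resample omega k 0) x + u (x - k) * v.
Proof.
have -> : u (x - k) * v = \sum_(j <- Theta) (j == x - k)%:R * (v * u j).
  have [xkT|xkT] := boolP (x - k \in Theta).
    rewrite (bigD1_seq (x - k))//= eqxx mul1r big1 ?addr0 1?mulrC// => j /negPf ->.
    by rewrite mul0r.
  rewrite u_out// mul0r big_seq big1// => j jT.
  by case: eqP => [jx|]; rewrite ?mul0r//; move: xkT; rewrite -jx jT.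
rewrite /potential -big_split; apply: eq_bigr => j _ /=; rewrite /resample.
have -> : (j == x - k) = (x - j == k) by rewrite subr_eq eq_sym subr_eq addrC.
by case: eqP => _; rewrite ?mul0r ?addr0// add0r mul1r.
Qed.

Lemma potential_resample_out omega k v x : x - k \notin Theta ->
  potential u Theta (resample omega k v) x = potential u Theta omega x.
Proof.
move=> xkT; apply: eq_big_seq => j jT; rewrite /resample; case: eqP => // xjk.
by move: xkT; rewrite -xjk opprB addrC subrK jT.
Qed.

Lemma potential_le omega x (M umax : R) : 0 <= M ->
  (forall j, j \in Theta -> `|omega (x - j)| <= M) ->
  (forall j, j \in Theta -> `|u j| <= umax) ->
  `|potential u Theta omega x| <= (size Theta)%:R * (M * umax).
Proof.
move=> M0 omegaM umaxP; apply: (le_trans (ler_norm_sum _ _ _)).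
apply: (@le_trans _ _ (\sum_(j <- Theta) M * umax)).
  rewrite big_seq [leRHS]big_seq; apply: ler_sum => j jT.
  by rewrite normrM ler_pM// ?omegaM ?umaxP.
by rewrite big_const_seq count_predT iter_addr_0 -[leLHS]mulr_natl.
Qed.

Hypothesis d0 : (0 < d)%N.
Hypothesis T0 : 0 \in Theta.
Hypothesis uB : forall k, k \in interior_boundary Theta -> 0 < u k.

Lemma size_Theta_gt0 : (0 < size Theta)%N.
Proof. by case: (Theta) T0. Qed.

Lemma card_support N (pt : 'I_N -> Zd d) k : injective pt ->
  (\sum_i ((pt i - k)%R \in Theta) <= size Theta)%N.
Proof.
move=> pt_inj; pose A : {set 'I_N} := [set i | pt i - k \in Theta]%SET.
have -> : (\sum_i ((pt i - k)%R \in Theta) = #|A|)%N.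
  rewrite -sum1_card [RHS]big_mkcond; apply: eq_bigr => i _.
  by rewrite inE; case: (_ \in _).
rewrite cardE -(size_map (fun i => pt i - k)); apply: uniq_leq_size.
  by rewrite map_inj_uniq ?enum_uniq// => i j /addIr/pt_inj.
by move=> j /mapP[l]; rewrite mem_enum inE => lA ->.
Qed.

(** The order of quantifiers is the point: [K] is fixed before the law, the volume, [z], [lam] and
    the background couplings, and [lam] enters only through the prefactor. *)
Lemma gfin_average (M umin umax c t : R) :
  (forall j, j \in Theta -> umin <= `|u j| <= umax) -> 0 < umin -> 0 <= M -> 0 <= c ->
  0 <= t -> t * (size Theta)%:R <= 2^-1 ->
  exists2 K : R, 0 <= K &
  forall (nu : probability (measurableTypeR R) R),
  (forall a r : R, 0 <= r -> (nu [set v | (`|v - a| <= r)%R] <= (c * r)%:E)%E) ->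
  {ae nu, forall v : measurableTypeR R, `|v| <= M} ->
  forall N (pt : 'I_N -> Zd d) (G : {set 'I_N}) lam z omega k x a,
  injective pt -> 1 <= lam -> complex.Im z != 0 ->
  (forall i j, j \in Theta -> `|omega (pt i - j)| <= M) ->
  x \in G -> pt x - k \in interior_boundary Theta ->
  a \in G -> pt a - k \in interior_boundary Theta ->
  (\int[nu]_v (cabs (gfin pt lam z G (resample omega k v) x a) `^ t)%:E
   <= ((2 / (lam * umin)) `^ t * K)%:E)%E.
Proof.
move=> uu umin0 M0 c0 t0 tn.
have uminmax : umin <= umax by have /andP[h1 h2] := uu _ T0; exact: le_trans h2.
have Delta0 : 0 < (2 * d)%:R :> R by rewrite ltr0n muln_gt0.
have Wm0 : 0 <= (size Theta)%:R * (M * umax).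
  by rewrite !mulr_ge0// (le_trans (ltW umin0)).
have [K K0 KP] := green_average size_Theta_gt0 Delta0 umin0 uminmax Wm0 M0 c0 t0 tn.
exists K => // nu nub nuM N pt G lam z omega k x a pt_inj lam1 z0 omegaM xG xB aG aB.
pose W i := potential u Theta (resample omega k 0) (pt i).
pose us i := u (pt i - k).
pose B : {set 'I_N} := [set i | pt i - k \in interior_boundary Theta]%SET.
pose I : {set 'I_N} :=
  [set i | (pt i - k \in Theta) && (pt i - k \notin interior_boundary Theta)]%SET.
have BT i : i \in B -> pt i - k \in Theta by rewrite inE mem_filter => /andP[].
have := KP nu nub nuM N (hop pt) G B I us W lam z.
under eq_integral => v _.
  rewrite /gfin /gmx.
  under [X in opmx _ _ X]eq_fun do rewrite potential_resample.
  over.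
apply => //.
- exact: hop_sym.
- exact: hop_ge0.
- by move=> i; rewrite !inE => ->; rewrite andbF.
- move=> i iB; rewrite /us -[leRHS]gtr0_norm.
    by have /andP[] := uu _ (BT _ iB).
  by apply: uB; rewrite inE in iB.
- by move=> i; rewrite inE => /andP[iT _]; exact: uu.
- move=> i; rewrite !inE => /negPf ->; rewrite andbT => iT.
  exact: u_out.
- apply: leq_trans (card_support k pt_inj); apply: leq_sum => i _.
  rewrite /us; have [/uTheta -> //|] := boolP (u (pt i - k) != 0).
  by [].
- by move=> i _ _; exact: hop_row_sum.
- move=> i j _ _; rewrite !inE => /andP[iT iB] /hop_neq0 ij.
  have jT : pt j - k \in Theta.
    apply: (not_interior_boundary uT iT iB).
    move: ij; rewrite !mem_cat => /orP[] /mapP[l _ ->]; apply/orP; [left|right];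
      by apply/mapP; exists l; rewrite ?mem_enum// addrAC.
  by rewrite jT; case: (_ \in interior_boundary _).
- move=> i _; apply: potential_le => // j jT; last by have /andP[] := uu _ jT.
  by rewrite /resample; case: eqP => _; [rewrite normr0|exact: omegaM].
- by rewrite inE.
- by rewrite inE.
Qed.

End FiniteVolumeGreen.

Section FractionalMomentStep.
Context {R : realType} {d : nat} {dT : measure_display} {T : measurableType dT}.
Context {P : probability T R} {rho : R -> R} {omega : Zd d -> T -> R}.
Hypothesis iid : iid_with_density P rho omega.
Variables (u : Zd d -> R) (Theta : seq (Zd d)) (M : R).
Hypothesis rhoM : forall t, M < `|t| -> rho t = 0.
Local Notation env w := (fun k => omega k w).
Local Open Scope ereal_scope.

(** The conditional bound is uniform only over bounded backgrounds; a finite volume involves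
    finitely many couplings, so the exceptional set is a finite union of null sets. *)
Lemma ae_couplings_bounded N (pt : 'I_N -> Zd d) :
  {ae P, forall w, forall i j, j \in Theta -> (`|omega (pt i - j)%R w| <= M)%R}.
Proof.
have bounded (s : seq (Zd d)) : {ae P, forall w, forall k, k \in s -> (`|omega k w| <= M)%R}.
  elim: s => [|k s [E [mE PE sE]]].
    by exists set0; split => // w /= []; move=> k; rewrite in_nil.
  have [E' [mE' PE' sE']] := ae_coupling_bounded iid k rhoM.
  exists (E `|` E'); split; first exact: measurableU.
    by rewrite measureU0.
  move=> w /= h; apply: contrapT => /not_orP[nE nE']; apply: h => j; rewrite inE => /orP[/eqP ->|js].
    by apply: contrapT => hk; apply: nE'; exact: sE'.
  by apply: contrapT => hj; apply: nE; apply: sE => /(_ _ js).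
have [E [mE PE sE]] := bounded [seq (pt i - j)%R | i <- enum 'I_N, j <- Theta].
exists E; split => // w /= h; apply: sE => /= hs; apply: h => i j jT; apply: hs.
by apply/allpairsP; exists (i, j); rewrite mem_enum.
Qed.

(** Conditioning on all couplings but [k]. The factor [Fr] is abstract so as to cover both the
    depleted resolvent and the constant 1 needed on the diagonal. *)
Lemma moment_step N (pt : 'I_N -> Zd d) (G : {set 'I_N}) (lam kappa t : R) (z : R[i])
    k x a (Fr : (Zd d -> R) -> R) :
  complex.Im z != 0%R -> (0 <= kappa)%R ->
  (forall om, (forall i j, j \in Theta -> `|om (pt i - j)%R| <= M)%R ->
    \int[coupling_law iid k]_v
      (cabs (gfin u Theta pt lam z G (resample om k v) x a) `^ t)%:E <= kappa%:E) ->
  (forall om, 0 <= Fr om)%R -> (forall om v, Fr (resample om k v) = Fr om) ->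
  (forall (dS : measure_display) (S : measurableType dS) (om : Zd d -> S -> R),
    (forall j, measurable_fun setT (om j)) ->
    measurable_fun setT (fun s => Fr (fun j => om j s))) ->
  \int[P]_w (cabs (gfin u Theta pt lam z G (env w) x a) `^ t * Fr (env w))%:E <=
  kappa%:E * \int[P]_w (Fr (env w))%:E.
Proof.
move=> z0 kappa0 avg Fr0 Frk mFr.
pose S := (measurableTypeR R * g_sigma_algebraType (other_cylinders k (omega := omega)))%type.
pose F om := (cabs (gfin u Theta pt lam z G om x a) `^ t)%R.
(* In [Fr] the coupling at [k] gets the arbitrary value 0: the value of [Fr] is unchanged, and its
   measurability in the other couplings becomes visible. *)
pose f (s : S) : \bar R := (F (resample (env s.2) k s.1) * Fr (resample (env s.2) k 0%R))%:E.
have mom : measurable_fun setT (fun w => Fr (env w)).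
  by apply: mFr => j; exact: coupling_measurable iid j.
have fE w : f (omega k w, w) = (F (env w) * Fr (env w))%:E.
  by rewrite /f /= Frk resample_id.
under eq_integral do rewrite -fE.
rewrite -ge0_integralZl_EFin//; [|by move=> w _; rewrite lee_fin|exact/measurable_EFinP].
have mj j : j != k -> measurable_fun setT (fun s : S => omega j s.2).
  move=> jk; apply: (measurableT_comp (measurable_other_coupling jk)).
  exact: measurable_snd.
apply: (@integral_coupling_le _ _ _ _ _ _ _ iid k f).
- rewrite /f; apply/measurable_EFinP; apply: measurable_funM.
    apply: (@measurable_gfin _ _ _ _ _ _ _ _ _ _ S (fun j s => resample (env s.2) k s.1 j)) => // j.
    rewrite /resample; have [_|jk] := eqVneq j k; last exact: mj.
    exact: measurable_fst.
  apply: (mFr _ S (fun j s => resample (env s.2) k 0%R j)) => j.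
  rewrite /resample; have [_|jk] := eqVneq j k; last exact: mj.
  exact: measurable_cst.
- by move=> s; rewrite lee_fin mulr_ge0 ?powR_ge0.
- by apply: measurable_funeM; exact/measurable_EFinP.
- by move=> w; rewrite -EFinM lee_fin mulr_ge0.
have [E [mE PE sE]] := ae_couplings_bounded pt.
exists E; split => // w /= hw; apply: sE => /= wM; apply: hw.
rewrite /f /= Frk; under eq_integral do rewrite mulrC EFinM.
rewrite ge0_integralZl_EFin//.
- by rewrite muleC lee_wpmul2r ?lee_fin//; exact: avg.
- by move=> v _; rewrite lee_fin powR_ge0.
apply/measurable_EFinP.
apply: (@measurable_gfin _ _ _ _ _ _ _ _ _ _ (measurableTypeR R)
  (fun j v => resample (env w) k v j)) => // j.
rewrite /resample; case: (j == k); first exact: measurable_id.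
exact: measurable_cst.
Qed.

End FractionalMomentStep.

Section FiniteVolumeDecay.
Context {R : realType} {d : nat}.


Lemma linfnormN (x : Zd d) : linfnorm (- x) = linfnorm x.
Proof. by apply: eq_bigr => i _; rewrite mxE abszN. Qed.

Lemma linfnorm_unitv (l : 'I_d) : (linfnorm (unitv l) <= 1)%N.
Proof. by apply/bigmax_leqP => i _; rewrite !mxE; case: (_ && _). Qed.

Lemma linfnorm_neighbour (x y : Zd d) : y \in neighbours x -> (linfnorm (x - y)%R <= 1)%N.
Proof.
rewrite mem_cat => /orP[] /mapP[l _ ->].
  by rewrite opprD addrA subrr sub0r linfnormN linfnorm_unitv.
by rewrite opprB addrC subrK linfnorm_unitv.
Qed.

Lemma opmx_eq_diag N (h : 'I_N -> 'I_N -> R) (G : {set 'I_N}) D D' :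
  (forall i, i \in G -> D i = D' i) -> opmx h G D = opmx h G D'.
Proof.
move=> DD'; apply/matrixP => i j; rewrite !mxE.
by case: ifP => // /andP[iG _]; rewrite DD'.
Qed.

Lemma decoupling_powR N (G K : {set 'I_N}) (h : 'I_N -> 'I_N -> R) (D : 'I_N -> R[i])
    (t : R) (x y : 'I_N) :
  (forall i j, 0 <= h i j) -> (forall i j, h i j != 0 -> 1 <= h i j) ->
  0 < t -> t <= 1 ->
  opmx h G D \in unitmx -> opmx h (G :\: K) D \in unitmx ->
  x \in G -> x \in K -> y \in G -> y \notin K ->
  cabs (invmx (opmx h G D) x y) `^ t <=
  \sum_(c in G :&: K) \sum_(b in G :\: K) h c b *
    (cabs (invmx (opmx h G D) x c) `^ t * cabs (invmx (opmx h (G :\: K) D) b y) `^ t).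
Proof.
move=> h0 h1 t0 t1 uM uM' xG xK yG yK.
rewrite (resolvent_decoupling uM uM' xG xK yG yK) pair_big_dep /= [leRHS]pair_big_dep /=.
apply: (@le_trans _ _ ((\sum_(p | (p.1 \in G :&: K) && (p.2 \in G :\: K))
  cabs (invmx (opmx h G D) x p.1 * ((h p.1 p.2)%:C)%C * invmx (opmx h (G :\: K) D) p.2 y)) `^ t)).
  apply: ge0_ler_powR; rewrite ?nnegrE ?cabs_ge0 ?(ltW t0)//.
    by apply: sumr_ge0 => p _; exact: cabs_ge0.
  exact: ler_cabs_sum.
apply: (le_trans (powR_sum_le _ _ t0 t1 _)); first by move=> p; exact: cabs_ge0.
apply: ler_sum => p _; rewrite !cabsM cabs_real ger0_norm//.
rewrite !powRM ?mulr_ge0 ?cabs_ge0// mulrAC mulrC ler_wpM2r ?mulr_ge0 ?powR_ge0//.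
have [->|hp] := eqVneq (h p.1 p.2) 0; first by rewrite powR0 ?gt_eqF.
by apply: ler1_powR => //; exact: h1.
Qed.

Context {dT : measure_display} {T : measurableType dT}.
Context {P : probability T R} {rho : R -> R} {omega : Zd d -> T -> R}.
Hypothesis iid : iid_with_density P rho omega.
Variables (u : Zd d -> R) (Theta : seq (Zd d)) (M : R).
Hypothesis rhoM : forall t, M < `|t| -> rho t = 0.
Hypothesis d0 : (0 < d)%N.
Hypothesis uT : uniq Theta.
Hypothesis uTheta : forall k, u k != 0 <-> k \in Theta.
Hypothesis T0 : 0 \in Theta.
Local Notation env w := (fun k => omega k w).

(** Induction on the cardinality of [G]. A decoupling step has at most [2 * d] hops from each of at
    most |Theta| points, each with a factor [kappa], and brings the first argument nearer to [y] by
    at most [r]; the smallness condition says that these losses together are at most 1. *)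
Lemma finite_volume_decay (lam kappa t : R) (r : nat) (z : R[i]) :
  complex.Im z != 0 -> 0 < t -> t <= 1 -> 0 <= kappa ->
  (2 * d)%:R * (size Theta)%:R * kappa * expR r%:R <= 1 ->
  (forall i j, i \in Theta -> j \in Theta -> (linfnorm (i - j)%R + 1 <= r)%N) ->
  (forall N (pt : 'I_N -> Zd d) (G : {set 'I_N}) om k x a, injective pt ->
    (forall i j, j \in Theta -> `|om (pt i - j)| <= M) ->
    x \in G -> pt x - k \in interior_boundary Theta ->
    a \in G -> pt a - k \in interior_boundary Theta ->
    (\int[coupling_law iid k]_v
      (cabs (gfin u Theta pt lam z G (resample om k v) x a) `^ t)%:E <= kappa%:E)%E) ->
  forall N (pt : 'I_N -> Zd d) (G : {set 'I_N}) (x y : 'I_N), injective pt ->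
  x \in G -> y \in G ->
  (\int[P]_w (cabs (gfin u Theta pt lam z G (env w) x y) `^ t)%:E <=
   (expR (- (linfnorm (pt x - pt y))%:R))%:E)%E.
Proof.
move=> z0 t0 t1 kappa0 small rT avg N pt G x y pt_inj.
have n0 := size_Theta_gt0 T0.
have momega N' (pt' : 'I_N' -> Zd d) G' a b :
    measurable_fun setT (fun w => cabs (gfin u Theta pt' lam z G' (env w) a b) `^ t).
  by apply: measurable_gfin => // k; exact: coupling_measurable iid k.
have [m] := ubnP #|G|; elim: m => // m IH in G x y * => Gm xG yG.
have [j jB jy] := extremal_boundary (pt x) (pt y) d0 uT T0.
pose k := pt x - j.
have xk : pt x - k = j by rewrite /k opprB addrC subrK.
have [xy|xy] := eqVneq x y.
  (* On the diagonal nothing is decoupled: [moment_step] with [Fr = 1] gives [kappa], which [small]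
     bounds by 1. *)
  subst y; rewrite subrr.
  have -> : linfnorm (0 : Zd d) = 0%N.
    by apply: big1 => i _; rewrite mxE.
  rewrite oppr0 expR0.
  have := @moment_step _ _ _ _ P rho omega iid u Theta M rhoM N pt G lam kappa t z k x x
    (fun=> 1) z0 kappa0.
  under eq_integral do rewrite mulr1.
  rewrite integral_cst//= probability_setT !mule1 => H.
  apply: (@le_trans _ _ kappa%:E).
    by apply: H => // om omM; apply: avg => //; rewrite xk.
  rewrite lee_fin; apply: le_trans small.
  have i3 : 1 <= expR r%:R :> R by rewrite -expR0 ler_expR.
  have i4 : 1 <= (2 * d)%:R * (size Theta)%:R :> R.
    by rewrite -natrM ler1n !muln_gt0 d0 n0.
  apply: (@le_trans _ _ ((2 * d)%:R * (size Theta)%:R * kappa)).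
    by rewrite ler_peMl.
  by rewrite ler_peMr// !mulr_ge0.
have pxy : pt x != pt y by rewrite (inj_eq pt_inj).
have yk : pt y - k \notin Theta by exact: jy.
pose K : {set 'I_N} := [set i | pt i - k \in Theta]%SET.
have jT : j \in Theta by move: jB; rewrite mem_filter => /andP[].
have xK : x \in K by rewrite inE xk.
have yK : y \notin K by rewrite inE.
pose E : R := expR (- (linfnorm (pt x - pt y))%:R).
have E0 : 0 <= E by exact: expR_ge0.
pose F c w := cabs (gfin u Theta pt lam z G (env w) x c) `^ t.
pose F' b w := cabs (gfin u Theta pt lam z (G :\: K) (env w) b y) `^ t.
(* Putting the membership conditions into the coefficient makes the sums range over all indices,
   ready for exchange with the integral. *)
pose a c b : R := if (c \in G :&: K) && (b \in G :\: K) then hop pt c b else 0.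
have a0 c b : 0 <= a c b by rewrite /a; case: ifP => // _; exact: hop_ge0.
have sumE (X : 'I_N -> 'I_N -> R) :
    \sum_(c in G :&: K) \sum_(b in G :\: K) hop pt c b * X c b = \sum_c \sum_b a c b * X c b.
  rewrite big_mkcond; apply: eq_bigr => c _; rewrite /a.
  case: ifP => _ /=; last by rewrite big1// => b _; rewrite mul0r.
  by rewrite big_mkcond; apply: eq_bigr => b _; case: ifP; rewrite ?mul0r.
have FF0 c b w : 0 <= F c w * F' b w by rewrite mulr_ge0 ?powR_ge0.
have mFF c b : measurable_fun setT (fun w => (a c b * (F c w * F' b w))%:E).
  apply/measurable_EFinP; apply: measurable_funM; first exact: measurable_cst.
  by apply: measurable_funM; exact: momega.
have pos c b w : (0%:E <= (a c b * (F c w * F' b w))%:E)%E by rewrite lee_fin mulr_ge0.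
apply: (@le_trans _ _ (\int[P]_w (\sum_c \sum_b (a c b * (F c w * F' b w))%:E))%E).
  apply: ge0_le_integral => //.
  - by move=> w _; rewrite lee_fin powR_ge0.
  - by apply/measurable_EFinP; exact: momega.
  - by apply: emeasurable_sum => c; apply: emeasurable_sum => b; exact: mFF.
  - move=> w _.
    under eq_bigr do rewrite sumEFin.
    rewrite sumEFin lee_fin -sumE.
    apply: decoupling_powR => //; [exact: hop_ge0|exact: hop_ge1|exact: gmx_unit|exact: gmx_unit].
rewrite ge0_integral_sum//; last 2 first.
- by move=> c; apply: emeasurable_sum => b; exact: mFF.
- by move=> c w _; apply: sume_ge0 => b _; exact: pos.
apply: (@le_trans _ _ (\sum_c \sum_b (a c b * (kappa * (expR r%:R * E)))%:E)%E); last first.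
  under eq_bigr do rewrite sumEFin.
  rewrite sumEFin lee_fin -sumE.
  apply: (@le_trans _ _ (\sum_(c in G :&: K) (2 * d)%:R * (kappa * (expR r%:R * E)))).
    apply: ler_sum => c _; rewrite -mulr_suml ler_wpM2r ?hop_row_sum//.
    by rewrite !mulr_ge0// expR_ge0.
  rewrite sumr_const -[leLHS]mulr_natl.
  apply: (@le_trans _ _ ((size Theta)%:R * ((2 * d)%:R * (kappa * (expR r%:R * E))))).
    rewrite ler_wpM2r ?mulr_ge0 ?expR_ge0// ler_nat.
    apply: leq_trans (card_support Theta k pt_inj).
    rewrite -sum1_card big_mkcond; apply: leq_sum => i _.
    by rewrite !inE; case: (i \in G) => //=; case: (_ \in Theta).
  rewrite (_ : _ * _ = (2 * d)%:R * (size Theta)%:R * kappa * expR r%:R * E); last by ring.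
  by rewrite ler_piMl.
apply: lee_sum => c _; rewrite ge0_integral_sum//.
apply: lee_sum => b _.
under eq_integral do rewrite EFinM.
rewrite ge0_integralZl_EFin//; last 2 first.
- by move=> w _; rewrite lee_fin.
- by apply/measurable_EFinP; apply: measurable_funM; exact: momega.
have [ac0|ac] := eqVneq (a c b) 0; first by rewrite ac0 mul0e mul0r.
rewrite [leRHS]EFinM lee_wpmul2l ?lee_fin//.
have : a c b != 0 by [].
rewrite {1}/a; case: ifP => [/andP[cGK bGK] hcb|_]; last by rewrite eqxx.
have /setIP[cG cK] := cGK; have /setDP[bG bK] := bGK.
have cT : pt c - k \in Theta by rewrite inE in cK.
have bT : pt b - k \notin Theta by rewrite inE in bK.
have bc := hop_neq0 hcb.
(* The neighbour [b] of [c] lies outside [K], so [c] cannot be interior. *)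
have cB : pt c - k \in interior_boundary Theta.
  apply: contraNT bT => /(not_interior_boundary uT cT); apply.
  move: bc; rewrite !mem_cat => /orP[] /mapP[l _ ->]; apply/orP; [left|right];
    by apply/mapP; exists l; rewrite ?mem_enum// addrAC.
apply: (@le_trans _ _ (kappa%:E * \int[P]_w (F' b w)%:E)%E).
  pose Fr om := cabs (gfin u Theta pt lam z (G :\: K) om b y) `^ t.
  have step := @moment_step _ _ _ _ P rho omega iid u Theta M rhoM N pt G lam kappa t z
    k x c Fr z0 kappa0.
  rewrite /F /F'; apply: step.
  - by move=> om omM; apply: avg pt_inj omM xG _ cG cB; rewrite xk.
  - by move=> om; exact: powR_ge0.
  - move=> om v; rewrite /Fr /gfin /gmx (@opmx_eq_diag _ _ _ _
      (fun i => ((lam * potential u Theta om (pt i))%:C)%C - z))// => i.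
    by rewrite !inE => /andP[iK _]; rewrite potential_resample_out.
  - by move=> dS S om mom; exact: measurable_gfin.
rewrite EFinM lee_wpmul2l ?lee_fin//.
apply: (le_trans (IH (G :\: K) b y _ bGK _)).
- rewrite -ltnS; apply: leq_trans Gm; rewrite ltnS; apply: proper_card.
  apply/properP; split; first exact: subsetDl.
  by exists x => //; rewrite inE xK.
- by rewrite inE yK.
rewrite lee_fin /E -expRD ler_expR.
have : (linfnorm (pt x - pt y)%R <= r + linfnorm (pt b - pt y)%R)%N.
  have -> : pt x - pt y = (j - (pt c - k)) + ((pt c - pt b) + (pt b - pt y)).
    by rewrite /k; apply/rowP => i; rewrite !mxE; ring.
  apply: (leq_trans (linfnormD _ _)).
  have h1 := linfnormD (pt c - pt b) (pt b - pt y).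
  have h2 := linfnorm_neighbour bc.
  have h3 := rT _ _ jT cT.
  apply: (leq_trans (leq_add (leqnn _) h1)).
  rewrite addnA leq_add2r; apply: leq_trans h3.
  by rewrite leq_add2l.
rewrite -(ler_nat R) natrD; lra.
Qed.

End FiniteVolumeDecay.

(** * Infinite volume *)

Section LimInf.
Context {R : realType}.
Local Open Scope ereal_scope.

Lemma limn_einf_ge (u : (\bar R)^nat) (a : \bar R) n0 :
  (forall n, (n0 <= n)%N -> a <= u n) -> a <= limn_einf u.
Proof.
move=> au; rewrite limn_einf_lim (cvg_lim _ (@cvg_einfs_sup _ u))//.
apply: (@le_trans _ _ (einfs u n0)); last by apply: ereal_sup_ubound; exists n0.
by apply: le_ereal_inf_tmp => _ [n /= nn0 <-]; exact: au.
Qed.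

Lemma limn_einf_le (u : (\bar R)^nat) (b : \bar R) :
  (forall n, u n <= b) -> limn_einf u <= b.
Proof.
move=> ub; rewrite limn_einf_lim (cvg_lim _ (@cvg_einfs_sup _ u))//.
apply: ge_ereal_sup => _ [n _ <-]; apply: le_trans (ub n).
by apply: ereal_inf_lbound; exists n => /=.
Qed.

(* No measurability: the integral of a nonnegative function is the supremum of
   the integrals of the simple functions below it. *)
Lemma integral_le_nonmeasurable d (T : measurableType d) (mu : {measure set T -> \bar R})
    (f g : T -> \bar R) :
  (forall x, 0 <= f x) -> (forall x, f x <= g x) -> \int[mu]_x f x <= \int[mu]_x g x.
Proof.
move=> f0 fg; have g0 x : 0 <= g x by exact: le_trans (fg x).
rewrite !ge0_integralTE//; apply: ge_ereal_sup => _ [h hf <-].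
by apply: ereal_sup_ubound; exists h => // x; exact: le_trans (fg x).
Qed.

End LimInf.

Section SquareSummable.
Context {R : realType} {d : nat}.
Local Notation C := R[i].

(** A finite list [s0] comes within [tau] of the supremum of the finite partial sums; whatever is
    disjoint from it can add at most [tau]. Beyond all the codes of [s0], disjointness is
    automatic. *)
Lemma l2_tail (G : set (Zd d)) (psi : Zd d -> C) (tau : R) : in_l2 G psi -> 0 < tau ->
  exists L, forall s : seq (Zd d), uniq s ->
    (forall c, c \in s -> (L <= pickle c)%N) -> \sum_(c <- s) cabs (psi c) ^+ 2 <= tau.
Proof.
move=> [psi0 l2] tau0; pose a c := cabs (psi c) ^+ 2.
have a0 c : 0 <= a c by exact: sqr_ge0.
pose A : set R := [set r | exists s, [/\ uniq s, forall c, c \in s -> G c & r = \sum_(c <- s) a c]].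
have esumfin : (\esum_(k in G) (a k)%:E \is a fin_num)%E.
  by rewrite ge0_fin_numE//; apply: esum_ge0 => c _; rewrite lee_fin.
have Aub r : A r -> r <= fine (\esum_(k in G) (a k)%:E)%E.
  move=> [s [us sG ->]]; rewrite -lee_fin fineK//; apply: esum_ge.
  exists [set` s]; first by split; [exact: finite_seq|move=> c /= /sG].
  by rewrite -fsbig_seq// sumEFin.
have Asup : has_sup A.
  split; first by exists 0, [::]; rewrite big_nil.
  by exists (fine (\esum_(k in G) (a k)%:E)%E) => r /Aub.
have [_ [s0 [us0 s0G ->]] hs0] := sup_adherent tau0 Asup.
exists (\max_(c <- s0) pickle c).+1 => s us sL.
pose s1 := [seq c <- s | c \in G].
have -> : \sum_(c <- s) a c = \sum_(c <- s1) a c.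
  rewrite big_filter [LHS](bigID (fun c => c \in G))/= [X in _ + X]big1 ?addr0//.
  by move=> c /negP cG; rewrite /a psi0 ?cabs0 ?expr0n// => /mem_set.
have As : A (\sum_(c <- s0 ++ s1) a c).
  exists (s0 ++ s1); split => //.
    rewrite cat_uniq us0 filter_uniq// andbT; apply/hasPn => c.
    rewrite mem_filter => /andP[_ /sL]; apply: contraTN => cs0.
    by rewrite -ltnNge ltnS; exact: leq_bigmax_seq.
  by move=> c; rewrite mem_cat mem_filter => /orP[/s0G//|/andP[/set_mem]].
have := ub_le_sup (proj2 Asup) As; rewrite big_cat/= -/a; lra.
Qed.

(** The difference of the two sides is half the double sum of [(a i - a j) ^+ 2]. *)
Lemma sqr_sum_le (I : Type) (s : seq I) (a : I -> R) :
  (\sum_(i <- s) a i) ^+ 2 <= (size s)%:R * \sum_(i <- s) a i ^+ 2.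
Proof.
have e : \sum_(i <- s) \sum_(j <- s) (a i - a j) ^+ 2 =
    2 * ((size s)%:R * \sum_(i <- s) a i ^+ 2) - 2 * (\sum_(i <- s) a i) ^+ 2.
  transitivity (\sum_(i <- s) ((size s)%:R * a i ^+ 2 +
      \sum_(j <- s) a j ^+ 2 - 2 * (a i * \sum_(j <- s) a j))).
    apply: eq_bigr => i _.
    have -> : (size s)%:R * a i ^+ 2 = \sum_(j <- s) a i ^+ 2.
      by rewrite big_const_seq count_predT iter_addr_0 mulr_natl.
    rewrite mulr_sumr mulr_sumr -big_split -sumrB /=; apply: eq_bigr => j _; ring.
  rewrite sumrB big_split /= -mulr_sumr -mulr_sumr -mulr_suml.
  rewrite big_const_seq count_predT iter_addr_0 -[X in _ + X - _]mulr_natl; ring.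
have : 0 <= \sum_(i <- s) \sum_(j <- s) (a i - a j) ^+ 2.
  by apply: sumr_ge0 => i _; apply: sumr_ge0 => j _; exact: sqr_ge0.
by rewrite e; lra.
Qed.

End SquareSummable.

Section FiniteVolumeApproximation.
Context {R : realType} {d : nat}.
Local Notation C := R[i].
Variables (u : Zd d -> R) (Theta : seq (Zd d)).

Definition exhaustion (L : nat) : seq (Zd d) := pmap (@pickle_inv (Zd d)) (iota 0 L).

Lemma mem_exhaustion L x : (x \in exhaustion L) = (pickle x < L)%N.
Proof.
rewrite mem_pmap; apply/mapP/idP => [[n]|xL].
  by rewrite mem_iota => /= nL /esym e; have := @pickle_invK (Zd d) n; rewrite e /= => ->.
by exists (pickle x); rewrite ?mem_iota// pickleK_inv.
Qed.

Lemma exhaustion_uniq L : uniq (exhaustion L).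
Proof. exact/(pmap_uniq (@pickle_invK _))/iota_uniq. Qed.

Definition site L (i : 'I_(size (exhaustion L))) : Zd d := nth 0 (exhaustion L) i.

Lemma site_inj L : injective (@site L).
Proof.
move=> i j /eqP; rewrite nth_uniq ?exhaustion_uniq// => /eqP; exact: val_inj.
Qed.

Lemma site_surj L x : (pickle x < L)%N -> exists i, @site L i = x.
Proof.
rewrite -mem_exhaustion => xL; have := xL; rewrite -index_mem => h.
by exists (Ordinal h); rewrite /site nth_index.
Qed.

Definition volume L (Gamma : set (Zd d)) : {set 'I_(size (exhaustion L))} :=
  [set i | site i \in Gamma]%SET.

Lemma sum_volume L (Gamma : set (Zd d)) (psi : Zd d -> C) c :
  (forall k, ~ Gamma k -> psi k = 0) ->
  \sum_(j in volume L Gamma) (site j == c)%:R * psi (site j) =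
  if (pickle c < L)%N then psi c else 0.
Proof.
move=> psi0; case: ifPn => [/site_surj[j0 j0c]|cL].
  have [j0G|j0G] := boolP (j0 \in volume L Gamma).
    rewrite (bigD1 j0)//= j0c eqxx mul1r big1 ?addr0// => j /andP[_ jj0].
    by rewrite -j0c (inj_eq (@site_inj L)) (negPf jj0) mul0r.
  rewrite big1 => [|j jG].
    apply/esym; apply: psi0 => Gc; move: j0G.
    by rewrite inE j0c => /negP; apply; exact: mem_set.
  rewrite -j0c (inj_eq (@site_inj L)); case: eqP => [jj0|]; rewrite ?mul0r//.
  by move: j0G; rewrite -jj0 jG.
rewrite big1// => j _; case: eqP => [jc|]; rewrite ?mul0r//.
by move: cL; rewrite -mem_exhaustion -jc mem_nth.
Qed.

(** Truncated to the volume, [psi] solves the finite-volume equation up to hopping to the sites cut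
    off, a tail of an l2 function; coercivity from [Im z] transfers the smallness to the entry. Any
    l2 solution will do, so the choice made in [green] is harmless. *)
Lemma green_approx lam omega (Gamma : set (Zd d)) (z : C) x y psi (eps : R) :
  complex.Im z != 0 -> Gamma x -> Gamma y ->
  resolvent_col u Theta lam omega Gamma z y psi -> 0 < eps ->
  exists L0, forall L (i j : 'I_(size (exhaustion L))), (L0 <= L)%N ->
  site i = x -> site j = y ->
  cabs (psi x - gfin u Theta (@site L) lam z (volume L Gamma) omega i j) <= eps.
Proof.
move=> z0 Gx Gy [l2 eqpsi] eps0; have psi0 := proj1 l2.
have extE k : extz Gamma psi k = psi k.
  rewrite /extz; case: ifPn => // kG; apply/esym/psi0 => Gk.
  by move/negP: kG; apply; exact: mem_set.
pose eta : R := `|complex.Im z|; have eta0 : 0 < eta by rewrite normr_gt0.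
(* The squared error will be at most [(2 * d) ^+ 2 * tau]; the added 1 keeps the denominator
   positive even for [d = 0]. *)
pose tau := (eps * eta / ((2 * d)%:R + 1)) ^+ 2.
have D0 : 0 < (2 * d)%:R + 1 :> R by rewrite ltr_wpDl.
have tau0 : 0 < tau by rewrite exprn_gt0// divr_gt0// mulr_gt0.
have [L0 tail] := l2_tail l2 tau0.
exists L0 => L ix iy LL ixx iyy.
set G := volume L Gamma; set M := gmx u Theta (@site L) lam z G omega.
have uM : M \in unitmx by exact: gmx_unit.
have ixG : ix \in G by rewrite inE ixx mem_set.
have iyG : iy \in G by rewrite inE iyy mem_set.
pose psiL : 'cV[C]_(size (exhaustion L)) := \col_i if i \in G then psi (site i) else 0.
pose tl (c : Zd d) : C := if (pickle c < L)%N then 0 else psi c.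
pose err (i : 'I_(size (exhaustion L))) : C :=
  \sum_(l < d) (tl (site i + unitv l) + tl (site i - unitv l)).
have Mpsi i : (M *m psiL) i 0 = (i == iy)%:R + (if i \in G then err i else 0).
  have [iG|iG] := boolP (i \in G); last first.
    rewrite opmx_out// mxE (negPf iG) addr0; case: eqP => // iiy.
    by rewrite iiy iyG in iG.
  have Gi : Gamma (site i) by move: iG; rewrite inE => /set_mem.
  have := eqpsi _ Gi; rewrite /HGamma => H.
  rewrite opmx_in// mxE iG.
  have -> : (i == iy)%:R = (site i == y)%:R :> C by rewrite -iyy (inj_eq (@site_inj L)).
  rewrite -H.
  have -> : \sum_(j in G) ((hop (@site L) i j)%:C)%C * psiL j 0 =
      \sum_(l < d) ((psi (site i + unitv l) - tl (site i + unitv l)) +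
                    (psi (site i - unitv l) - tl (site i - unitv l))).
    transitivity (\sum_(l < d) (\sum_(j in G) (site j == site i + unitv l)%:R * psi (site j) +
        \sum_(j in G) (site j == site i - unitv l)%:R * psi (site j))).
      under [RHS]eq_bigr do rewrite -big_split /=.
      rewrite [RHS]exchange_big /=; apply: eq_bigr => j jG.
      rewrite mxE jG rmorph_sum mulr_suml; apply: eq_bigr => l _.
      by rewrite rmorphD /= !rmorph_nat mulrDl.
    apply: eq_bigr => l _; rewrite !sum_volume// /tl.
    by congr (_ + _); case: ifP; rewrite ?subr0 ?subrr.
  under [in RHS]eq_bigr do rewrite !extE.
  rewrite /err.
  have -> : \sum_(l < d) (psi (site i + unitv l) - tl (site i + unitv l) +
        (psi (site i - unitv l) - tl (site i - unitv l))) =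
      \sum_(l < d) (psi (site i + unitv l) + psi (site i - unitv l)) -
      \sum_(l < d) (tl (site i + unitv l) + tl (site i - unitv l)).
    rewrite -sumrB; apply: eq_bigr => l _; ring.
  ring.
pose phi := psiL - col iy (invmx M).
have Mphi i : (M *m phi) i 0 = if i \in G then err i else 0.
  rewrite mulmxBr colE mulmxA mulmxV// mul1mx mxE Mpsi [X in _ + X]mxE mxE.
  by rewrite eqxx andbT addrC addKr.
have phix : phi ix 0 = psi x - invmx M ix iy.
  by rewrite !mxE ixG ixx.
rewrite /gfin -/M -phix.
pose sg : R := - Num.sg (complex.Im z).
have sg1 : `|sg| = 1 by rewrite normrN normr_sg z0.
have := @opmx_coercive _ _ (hop (@site L)) G
  (fun i => ((lam * potential u Theta omega (site i))%:C)%C - z) phi sg eta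
  (hop_sym _) sg1 eta0.
have DIm i : i \in G ->
    eta <= sg * complex.Im (((lam * potential u Theta omega (site i))%:C)%C - z).
  move=> _; have -> : complex.Im (((lam * potential u Theta omega (site i))%:C)%C - z) =
      - complex.Im z by case: (z) => ? ? /=; rewrite sub0r.
  by rewrite mulrNN -normrEsg.
move=> /(_ DIm) coer.
have tl_le (f : 'I_(size (exhaustion L)) -> Zd d) : injective f ->
    \sum_(i in G) cabs (tl (f i)) ^+ 2 <= tau.
  move=> finj.
  pose s := [seq f i | i <- enum G & ~~ (pickle (f i) < L)%N].
  have -> : \sum_(i in G) cabs (tl (f i)) ^+ 2 = \sum_(c <- s) cabs (psi c) ^+ 2.
    rewrite big_map big_filter big_enum_cond /= [LHS](bigID (fun i => (pickle (f i) < L)%N)) /=.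
    rewrite big1 ?add0r => [|i /andP[_ fL]]; last by rewrite /tl fL cabs0 expr0n.
    by apply: eq_bigr => i /andP[_ /negPf fL]; rewrite /tl fL.
  apply: tail; first by rewrite map_inj_uniq// filter_uniq// enum_uniq.
  move=> c /mapP[i0]; rewrite mem_filter -leqNgt => /andP[h _] ->.
  exact: leq_trans h.
have errle : \sum_(i in G) cabs (err i) ^+ 2 <= (eps * eta) ^+ 2.
  apply: (@le_trans _ _ (\sum_(i in G) (2 * d)%:R * \sum_(l < d)
      (cabs (tl (site i + unitv l)) ^+ 2 + cabs (tl (site i - unitv l)) ^+ 2))).
    apply: ler_sum => i _.
    apply: (@le_trans _ _ ((\sum_(l < d)
        (cabs (tl (site i + unitv l)) + cabs (tl (site i - unitv l)))) ^+ 2)).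
      rewrite ler_sqr ?nnegrE ?cabs_ge0//; last first.
        by apply: sumr_ge0 => l _; rewrite addr_ge0 ?cabs_ge0.
      apply: (le_trans (ler_cabs_sum _ _ _)); apply: ler_sum => l _.
      exact: ler_cabsD.
    apply: (le_trans (sqr_sum_le _ _)).
    rewrite (_ : size _ = d); last by rewrite -sum1_size sum1_card card_ord.
    rewrite natrM -mulrA mulrCA ler_wpM2l// mulr_sumr; apply: ler_sum => l _.
    have := sqr_ge0 (cabs (tl (site i + unitv l)) - cabs (tl (site i - unitv l))).
    lra.
  rewrite -mulr_sumr exchange_big /=.
  apply: (@le_trans _ _ ((2 * d)%:R * \sum_(l < d) (tau + tau))).
    rewrite ler_wpM2l//; apply: ler_sum => l _; rewrite big_split /=.
    by apply: lerD; apply: tl_le => i j /addIr /site_inj.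
  rewrite sumr_const card_ord -mulr2n -mulrnA -[X in _ * X]mulr_natl mulrA.
  have -> : (eps * eta) ^+ 2 = ((2 * d)%:R + 1) ^+ 2 * tau.
    by rewrite /tau -exprMn mulrCA divff ?mulr1// gt_eqF.
  rewrite ler_pM2r//; have : 0 <= (2 * d)%:R :> R by [].
  rewrite (mulnC 2 d); lra.
have : eta ^+ 2 * cabs (phi ix 0) ^+ 2 <= (eps * eta) ^+ 2.
  apply: le_trans errle.
  apply: (@le_trans _ _ (eta ^+ 2 * \sum_(i in G) cabs (phi i 0) ^+ 2)).
    rewrite ler_wpM2l ?sqr_ge0// (bigD1 ix)//= lerDl.
    by apply: sumr_ge0 => i _; exact: sqr_ge0.
  apply: (le_trans coer); apply: ler_sum => i iG.
  by rewrite -/M Mphi iG.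
rewrite exprMn mulrC ler_pM2r ?exprn_gt0//.
by rewrite ler_sqr// nnegrE ?cabs_ge0// ltW.
Qed.

End FiniteVolumeApproximation.

Section InfiniteVolume.
Context {R : realType} {d : nat} {dT : measure_display} {T : measurableType dT}.
Context {P : probability T R} {rho : R -> R} {omega : Zd d -> T -> R}.
Hypothesis iid : iid_with_density P rho omega.
Variables (u : Zd d -> R) (Theta : seq (Zd d)).
Local Notation env w := (fun k => omega k w).

(** Pointwise in [w], the power of [green] is at most the lower limit of the finite-volume powers,
    trivially so where [green] takes its default value 0. Fatou is applied to the measurable
    finite-volume functions only. *)
Lemma infinite_volume_le (lam t b : R) (Gamma : set (Zd d)) (z : R[i]) x y :
  complex.Im z != 0 -> Gamma x -> Gamma y -> 0 < t -> t <= 1 ->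
  (forall L (i j : 'I_(size (exhaustion L))), site i = x -> site j = y ->
    (\int[P]_w (cabs (gfin u Theta (@site d L) lam z (volume L Gamma) (env w) i j) `^ t)%:E
      <= b%:E)%E) ->
  (\int[P]_w (cabs (green u Theta lam (env w) Gamma z x y) `^ t)%:E <= b%:E)%E.
Proof.
move=> z0 Gx Gy t0 t1 fin.
pose L1 := (maxn (pickle x) (pickle y)).+1.
have Hx n : exists i, @site d (L1 + n) i = x.
  by apply: site_surj; rewrite ltn_addr// ltnS leq_maxl.
have Hy n : exists i, @site d (L1 + n) i = y.
  by apply: site_surj; rewrite ltn_addr// ltnS leq_maxr.
pose ix n := sval (cid (Hx n)); pose iy n := sval (cid (Hy n)).
have ixE n : site (ix n) = x by rewrite /ix; case: cid.
have iyE n : site (iy n) = y by rewrite /iy; case: cid.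
pose g n w := cabs (gfin u Theta (@site d (L1 + n)) lam z (volume (L1 + n) Gamma)
  (env w) (ix n) (iy n)).
pose f n w := (g n w `^ t)%:E.
have mf n : measurable_fun setT (f n).
  rewrite /f; apply/measurable_EFinP; rewrite /g; apply: measurable_gfin => // k.
  exact: coupling_measurable iid k.
have f0 n w : (0 <= f n w)%E by rewrite lee_fin powR_ge0.
apply: (@le_trans _ _ (\int[P]_w limn_einf (f ^~ w))%E); last first.
  apply: (le_trans (fatou _ measurableT _ _)) => //.
  by apply: limn_einf_le => n; exact: fin.
apply: integral_le_nonmeasurable => w; first by rewrite lee_fin powR_ge0.
rewrite /green; case: pselect => [ex|_]; last first.
  by rewrite cabs0 powR0 ?gt_eqF//; apply: (@limn_einf_ge _ _ _ 0).
case: (cid ex) => psi psiP /=.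
apply/lee_addgt0Pr => e e0.
(* Accuracy [e] to the power 1/t, so that its [t]-th power costs exactly [e] by subadditivity. *)
have [L0 approx] := green_approx z0 Gx Gy psiP (powR_gt0 t^-1 e0).
rewrite -leeBlDr// -EFinB; apply: (@limn_einf_ge _ _ _ L0) => n Ln.
rewrite lee_fin lerBlDr.
have := approx (L1 + n)%N (ix n) (iy n) (leq_trans Ln (leq_addl _ _)) (ixE n) (iyE n).
set gn := gfin _ _ _ _ _ _ _ _ _ => h.
apply: (@le_trans _ _ ((cabs gn + cabs (psi x - gn)) `^ t)).
  apply: ge0_ler_powR; rewrite ?nnegrE ?addr_ge0 ?cabs_ge0 ?(ltW t0)//.
  by rewrite (le_trans _ (ler_cabsD _ _))// addrC subrK.
apply: (le_trans (powR_subadditive t0 t1 (cabs_ge0 _) (cabs_ge0 _))).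
rewrite lerD2l; apply: (@le_trans _ _ ((e `^ t^-1) `^ t)).
  by apply: ge0_ler_powR; rewrite ?nnegrE ?powR_ge0 ?cabs_ge0 ?(ltW t0).
by rewrite -powRrM mulVf ?gt_eqF// powRr1// ltW.
Qed.

End InfiniteVolume.

Lemma seq_norm_bounds (R : realType) (T : eqType) (s : seq T) (f : T -> R) :
  (forall x, x \in s -> f x != 0) ->
  exists umin umax, 0 < umin /\ forall x, x \in s -> umin <= `|f x| <= umax.
Proof.
elim: s => [_|a s ih fs]; first by exists 1, 1; split.
have [x xs|m [M [m0 mM]]] := ih; first by apply: fs; rewrite inE xs orbT.
exists (Num.min m `|f a|), (Num.max M `|f a|); split.
  by rewrite lt_min m0 normr_gt0 fs// mem_head.
move=> x; rewrite inE => /orP[/eqP ->|/mM /andP[h1 h2]].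
  by rewrite ge_min le_max lexx !orbT.
by rewrite ge_min le_max h1 h2.
Qed.

Theorem theorem2p4 (R : realType) (d : nat) (rho : R -> R)
  (u : Zd d -> R) (Theta : seq (Zd d)) (s : R) :
  (1 <= d)%N ->
  uniq Theta ->
  (forall k, u k != 0 <-> k \in Theta) ->
  0 \in Theta ->
  bdd_cpt_density rho ->                                   (* (A1) *)
  (forall k, k \in interior_boundary Theta -> 0 < u k) ->  (* (A2) *)
  0 < s -> s < 1 / 3 ->
  exists lambda0 : R, forall lambda : R, lambda0 < lambda ->
  exists mu A : R, 0 < mu /\ 0 < A /\
  forall (dT : measure_display) (T : measurableType dT) (P : probability T R)
         (omega : Zd d -> T -> R),
  iid_with_density P rho omega ->
  forall (Gamma : set (Zd d)) (z : R[i]) (x y : Zd d),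
  complex.Im z != 0 -> Gamma x -> Gamma y ->
  (\int[P]_w ((cabs (green u Theta lambda (fun k => omega k w) Gamma z x y))
                 `^ (s / (2 * (size Theta)%:R)))%:E
   <= (A * expR (- mu * (linfnorm (x - y))%:R))%:E)%E.
Proof.
move=> d0 uT uTheta T0 [mrho [rho0 [[C rhoC] [[M0 rhoM0] _]]]] uB s0 s13.
set n := size Theta; have n0 : (0 < n)%N by exact: size_Theta_gt0.
have nR0 : 0 < n%:R :> R by rewrite ltr0n.
have nR1 : 1 <= n%:R :> R by rewrite ler1n.
pose t : R := s / (2 * n%:R).
have t0 : 0 < t by rewrite divr_gt0// mulr_gt0.
have tn : t * n%:R <= 2^-1.
  have -> : t * n%:R = s / 2 by rewrite /t; field; rewrite gt_eqF.
  lra.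
have t1 : t <= 1.
  have : t <= t * n%:R by rewrite ler_peMr// ltW.
  lra.
have [umin [umax [umin0 uu]]] := @seq_norm_bounds R _ Theta u (fun k => proj2 (uTheta k)).
pose M := `|M0|.
have rhoM v : M < `|v| -> rho v = 0.
  by move=> Mv; apply: rhoM0; apply: le_lt_trans Mv; exact: ler_norm.
have C0 : 0 <= C by exact: le_trans (rho0 0) (rhoC 0).
have [K K0 KP] := @gfin_average R d u Theta uT uTheta d0 T0 uB M umin umax (2 * C) t uu umin0
  (normr_ge0 _) (mulr_ge0 (ler0n _ 2) C0) (ltW t0) tn.
pose r := (2 * \max_(k <- Theta) linfnorm k + 1)%N.
have rT i j : i \in Theta -> j \in Theta -> (linfnorm (i - j)%R + 1 <= r)%N.
  move=> iT jT; rewrite leq_add2r mul2n -addnn.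
  apply: (leq_trans (linfnormD _ _)); rewrite linfnormN.
  by apply: leq_add; exact: leq_bigmax_seq.
pose Q : R := (2 * d)%:R * n%:R * K * expR r%:R.
have Q0 : 0 <= Q by rewrite !mulr_ge0// expR_ge0.
have Q1 : 0 < Q + 1 by rewrite ltr_wpDl.
(* Solves [(2 / (lam1 * umin))] to the power [t] equal to [1 / (Q + 1)]; beyond it the total loss
   per step is at most [Q / (Q + 1)]. *)
pose lam1 : R := 2 / umin * (Q + 1) `^ t^-1.
have lam10 : 0 < lam1 by rewrite mulr_gt0 ?powR_gt0// divr_gt0.
exists (Num.max 1 lam1) => lam; rewrite gt_max => /andP[lam_1 lam_lam1].
(* Rate 1 is affordable because [Q] already contains the factor [expR r%:R] lost per step. *)
exists 1, 1; split => //; split => //.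
move=> dT T P omega iid Gamma z x y z0 Gx Gy.
rewrite mul1r mulN1r.
have lam0 : 0 < lam by exact: lt_trans lam_1.
pose kappa : R := (2 / (lam * umin)) `^ t * K.
have kappa0 : 0 <= kappa by rewrite mulr_ge0// powR_ge0.
have small : (2 * d)%:R * n%:R * kappa * expR r%:R <= 1.
  have -> : (2 * d)%:R * n%:R * kappa * expR r%:R = (2 / (lam * umin)) `^ t * Q.
    by rewrite /kappa /Q; ring.
  apply: (@le_trans _ _ ((Q + 1)^-1 * Q)); last first.
    by rewrite mulrC ler_pdivrMr// mul1r lerDl.
  rewrite ler_wpM2r//.
  have -> : (Q + 1)^-1 = (((Q + 1) `^ t^-1)^-1) `^ t.
    by rewrite -powRN -powRrM mulNr mulVf ?gt_eqF// powR_inv1// ltW.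
  have P0 : 0 < (Q + 1) `^ t^-1 by exact: powR_gt0.
  apply: ge0_ler_powR; rewrite ?nnegrE ?(ltW t0)//.
  - by rewrite divr_ge0// mulr_ge0// ltW.
  - by rewrite invr_ge0 ltW.
  rewrite ler_pdivrMr ?mulr_gt0// mulrC ler_pdivlMr//.
  have -> : 2 * (Q + 1) `^ t^-1 = lam1 * umin.
    by rewrite /lam1 mulrAC divfK// gt_eqF.
  by rewrite ler_pM2r// ltW.
apply: (infinite_volume_le iid z0 Gx Gy t0 t1) => L i j ix jy.
have := @finite_volume_decay R d dT T P rho omega iid u Theta M rhoM d0 uT T0 lam
  kappa t r z z0 t0 t1 kappa0 small rT _ _ (@site d L) (volume L Gamma) i j (@site_inj d L).
rewrite ix jy; apply.
- move=> N pt G om k a b pt_inj omM aG aB bG bB.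
  apply: KP => //; last exact: ltW.
    by apply: coupling_law_ball => // v; rewrite rho0 rhoC.
  exact: ae_coupling_law_bounded.
- by rewrite inE ix mem_set.
- by rewrite inE jy mem_set.
Qed.
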